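(* Let $f:[0,2\pi]\to\mathbb{R}$ be a continuous real-valued function with absolutely summable Fourier series. Then the graph of $f$ has an infinite linkage realisation by a pointed locally finite linkage. That is, there exists an infinite plane linkage $(G,p)$, with articulating flex $p(t)=(p_1(t),p_2(t),\dots)$, $t\in[0,1]$, such that $(G,p)$ is locally finite and pointed, the limit $p^*(t)=\lim_{n\to\infty}p_n(t)$ exists for every $t\in[0,1]$ and defines a continuous plane curve, and $$\{p^*(t):t\in[0,1]\}=\{(s,f(s)):s\in[0,2\pi]\}.$$
   Context: A (bar-joint) framework in $\mathbb{R}^2$ is a pair $(G,p)$ where $G=(V,E)$ is a graph with countable vertex set $V=\{v_1,v_2,\dots\}$ and $p=(p_1,p_2,\dots)$ with $p_i\in\mathbb{R}^2$ the position of $v_i$. It is infinite if $V$ is countably infinite, connected if $G$ is connected, and locally finite if each vertex has finite degree. The length of an edge $(v_i,v_j)$ is $|p_i-p_j|$. Continuous flex of a framework $(G,p)$: a function $t\mapsto p(t)=(p_1(t),p_2(t),\dots)$ from $[0,1]$ to $\prod_V\mathbb{R}^2$ such that (i) $p(0)=p$; (ii) each $p_i(t)$ is continuous; (iii) for some base edge $(v_a,v_b)$ with $|p_a-p_b|\neq0$, $p_a(t)=p_a(0)$ and $p_b(t)=p_b(0)$ for all $t$; (iv) $|p_i(t)-p_j(t)|=|p_i(0)-p_j(0)|$ for all edges $(v_i,v_j)$ and all $t$; (v) $p(t)$ is not a constant function. Infinite plane linkage: an infinite connected framework $(G,p)$ in $\mathbb{R}^2$ with a degree two vertex $v_1$ with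 edges $(v_1,v_2),(v_1,v_3)$ and a continuous flex $p(t)$ (the articulating flex) such that (i) the cosine angle function $g(t)=\langle p_2(t)-p_1(t),\,p_3(t)-p_1(t)\rangle$ is strictly increasing on $[0,1]$ (where $\langle\cdot,\cdot\rangle$ is the usual inner product), and (ii) $p(t)$ is the unique flex $q(t)$ of $(G,p)$ with $q_i(t)=p_i(t)$ for $i=1,2,3$ and all $t$. Linkages are partially normalised so that $p_1(t)=(0,0)$ for all $t$. Pointed: $(G,p)$ is pointed if $p=(p_1,p_2,\dots)$ is a convergent sequence and the sequence of edge lengths (in an enumeration of the edges) tends to zero. *)

(* Defs.v *)
From Stdlib Require Import Reals Lra List Relations.
From Coquelicot Require Import Coquelicot.
Open Scope R_scope.

Definition point := (R * R)%type.

Definition dist (P Q : point) : R := dist_euc (fst P) (snd P) (fst Q) (snd Q).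

Definition vec (P Q : point) : point := (fst Q - fst P, snd Q - snd P).

Definition inner (u v : point) : R := fst u * fst v + snd u * snd v.

Definition interval (a b x : R) : Prop := a <= x <= b.

(* The vertex set {v_1, v_2, ...} is [nat], shifted by one: [n] stands for
   v_{n+1}.  Distinct vertices may have the same position. *)
Record infinite_framework := {
  adj : nat -> nat -> Prop;
  adj_sym : forall i j, adj i j -> adj j i;
  adj_irrefl : forall i, ~ adj i i;
  pos : nat -> point
}.

Definition connected (F : infinite_framework) : Prop :=
  forall i j, clos_refl_trans nat (adj F) i j.

Definition locally_finite (F : infinite_framework) : Prop :=
  forall i, exists l : list nat, forall j, adj F i j -> In j l.

(* Each undirected edge is listed exactly once, as the pair (i, j) with i < j. *)
Definition edge_enumeration (F : infinite_framework) (e : nat -> nat * nat) : Prop :=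
  (forall k, (fst (e k) < snd (e k))%nat /\ adj F (fst (e k)) (snd (e k))) /\
  (forall k l, e k = e l -> k = l) /\
  (forall i j, (i < j)%nat -> adj F i j -> exists k, e k = (i, j)).

Definition pointed (F : infinite_framework) : Prop :=
  (exists l : point, filterlim (pos F) eventually (locally l)) /\
  (exists e, edge_enumeration F e /\
     is_lim_seq (fun k => dist (pos F (fst (e k))) (pos F (snd (e k)))) 0).

(* A path [q] is defined on all of R, but only its restriction to [0, 1] matters. *)
Definition continuous_flex (F : infinite_framework) (q : R -> nat -> point) : Prop :=
  (forall i, q 0 i = pos F i) /\
  (forall i, continuous_on (interval 0 1) (fun t => q t i)) /\
  (exists a b, adj F a b /\ dist (pos F a) (pos F b) <> 0 /\
     forall t, interval 0 1 t -> q t a = q 0 a /\ q t b = q 0 b) /\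
  (forall i j t, adj F i j -> interval 0 1 t ->
     dist (q t i) (q t j) = dist (q 0 i) (q 0 j)) /\
  (exists s t i, interval 0 1 s /\ interval 0 1 t /\ q s i <> q t i).

Definition cos_angle (p : R -> nat -> point) (t : R) : R :=
  inner (vec (p t 0%nat) (p t 1%nat)) (vec (p t 0%nat) (p t 2%nat)).

(* [F] is an infinite plane linkage with articulating flex [p], including the
   normalisation of v_1 at the origin. *)
Definition plane_linkage (F : infinite_framework) (p : R -> nat -> point) : Prop :=
  connected F /\
  (forall j, adj F 0 j <-> j = 1%nat \/ j = 2%nat) /\
  continuous_flex F p /\
  (forall s t, interval 0 1 s -> interval 0 1 t -> s < t ->
     cos_angle p s < cos_angle p t) /\
  (forall q, continuous_flex F q ->
     (forall t i, interval 0 1 t -> (i < 3)%nat -> q t i = p t i) ->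
     forall t i, interval 0 1 t -> q t i = p t i) /\
  (forall t, interval 0 1 t -> p t 0%nat = (0, 0)).

Definition fourier_cos (f : R -> R) (n : nat) : R :=
  / PI * RInt (fun x => f x * cos (INR n * x)) 0 (2 * PI).

Definition fourier_sin (f : R -> R) (n : nat) : R :=
  / PI * RInt (fun x => f x * sin (INR n * x)) 0 (2 * PI).

Definition fourier_abs_summable (f : R -> R) : Prop :=
  ex_series (fun n => Rabs (fourier_cos f n) + Rabs (fourier_sin f n)).

(* Main.v *)
Require Import Defs.
From Stdlib Require Import Reals Lra List Relations.
From Stdlib Require Import ZArith Lia Classical ClassicalEpsilon Cantor Wf_nat.
From Coquelicot Require Import Coquelicot.
Import ListNotations.
Open Scope R_scope.

(** Realising the graph of [f].  Write [x] for the angle of the input bar and [z]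
for exp(i x).  It suffices to let [x] run over the quarter turn from pi/4 to
3pi/4: the abscissa [s = 4 x - PI] then sweeps [0, 2 pi], and on this arc both
coordinates of the point (s, f(s)) are trigonometric series in [x].  For the
ordinate this is Fourier inversion for [f] ([fourier_inversion]), with harmonic
[n] of [s] becoming harmonic [4 n] of [x]; for the abscissa, which is not
periodic, it is Fourier inversion for the triangle wave |pi - x|, which is
affine on the arc and has coefficients of order 1/n^2.  Read as complex
numbers, the points (s, f(s)) are thus a sum of [c_m z^m] over all integers
[m], with [c_m] tending to 0.

The linkage adds these terms one at a time, in the order z, 1, z^2, z^-1, z^3,
z^-2, and so on.  Its state consists of a point [P], the current partial sum,
together with four bars at [P]: one pair in the last two directions of the
chain of increasing powers, one pair for the decreasing powers.  The next block
of 13 vertices does three things.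
- It continues a chain by a new bar, from the directions z^(k-1), z^k to
  z^(k+1), by two similar antiparallelograms with ratio 1/2 in the manner of
  Kempe.  The bars shrink at each use, as pointedness requires.  Two consecutive
  directions always enclose the same angle [x], which stays inside (0, pi), so
  these antiparallelograms never flatten although z^k itself winds round many
  times.
- It attaches the next partial sum [P'] rigidly to [P] and to a bar.
- It carries the four bars needed next from [P] to [P'].  The angle between a
  bar and PP' is arbitrary, so a plain parallelogram could flip; a third
  parallel bar between the midpoints excludes this ([parallelogram_unique]).

Uniqueness of the flex propagates from block to block ([agree_step]).  A vertex
attached to two vertices already determined is determined too: either the three
points are collinear, and there is a single solution, or they never are, and
the orientation of the triangle is constant by continuity ([dyad_unique]).

All vertices of a block are close to the partial sum, so the vertices converge
to (s, f(s)); as edges only join vertices of the same or of consecutive blocks,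
convergence of the positions already forces the edge lengths to tend to 0
([pointed_of_convergent]). *)

(** * Continuous functions annihilated by all trigonometric monomials *)

Ltac equation_in_R := match goal with |- ?l = ?r => change (@eq R l r) end.

Definition clamp (a b x : R) : R := Rmax a (Rmin b x).

Lemma clamp_in a b x : a <= b -> interval a b (clamp a b x).
Proof.
intros H; unfold interval, clamp, Rmax, Rmin.
repeat destruct Rle_dec; lra.
Qed.

Lemma clamp_id a b x : interval a b x -> clamp a b x = x.
Proof.
unfold interval, clamp, Rmax, Rmin; intros H.
repeat destruct Rle_dec; lra.
Qed.

(** Retracting the line onto a segment is continuous, so every function
    continuous on a segment extends to the line; this brings functions on [0,
    2 pi] and paths on [0, 1] under the theorems on functions of a real
    variable. *)
Lemma clamp_lipschitz a b x y : a <= b -> Rabs (clamp a b x - clamp a b y) <= Rabs (x - y).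
Proof.
intros H; unfold clamp, Rmax, Rmin.
repeat destruct Rle_dec; unfold Rabs; repeat destruct Rcase_abs; lra.
Qed.

Lemma continuous_clamp_ext {U : UniformSpace} (f : R -> U) a b :
  a <= b -> continuous_on (interval a b) f ->
  forall x, continuous (fun x => f (clamp a b x)) x.
Proof.
intros Hab Hf x.
apply (filterlim_comp _ _ _ (clamp a b) f _ (within (interval a b) (locally (clamp a b x)))).
- intros P [d Hd]; exists d; intros y Hy; apply Hd.
  + apply Rle_lt_trans with (2 := Hy). now apply clamp_lipschitz.
  + now apply clamp_in.
- apply Hf. now apply clamp_in.
Qed.

Lemma continuous_everywhere_on {U : UniformSpace} (f : R -> U) D :
  (forall x, continuous f x) -> continuous_on D f.
Proof.
intros H x _ P HP. destruct (H x P HP) as [d Hd]. exists d; auto.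
Qed.

Lemma continuous_cos_lin k a x : continuous (fun x => cos (k * x + a)) x.
Proof.
apply (ex_derive_continuous (fun x => cos (k * x + a))). auto_derive. auto.
Qed.

Lemma continuous_cos_mul k x : continuous (fun x => cos (k * x)) x.
Proof.
apply (ex_derive_continuous (fun x => cos (k * x))). auto_derive. auto.
Qed.

Lemma continuous_sin_mul k x : continuous (fun x => sin (k * x)) x.
Proof.
apply (ex_derive_continuous (fun x => sin (k * x))). auto_derive. auto.
Qed.

Lemma ex_RInt_everywhere (f : R -> R) a b : (forall x, continuous f x) -> ex_RInt f a b.
Proof. intros H; apply (ex_RInt_continuous f); intros; apply H. Qed.

Lemma continuous_mult_R (f g : R -> R) : (forall x, continuous f x) -> (forall x, continuous g x) ->
  forall x, continuous (fun x => f x * g x) x.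
Proof. intros Hf Hg x; apply (continuous_mult (K:=R_AbsRing) f g x (Hf x) (Hg x)). Qed.

Lemma continuous_plus_R (f g : R -> R) : (forall x, continuous f x) -> (forall x, continuous g x) ->
  forall x, continuous (fun x => f x + g x) x.
Proof. intros Hf Hg x; apply (continuous_plus (V:=R_NormedModule) f g x (Hf x) (Hg x)). Qed.

Lemma RInt_linear (f g : R -> R) u v a b :
  (forall x, continuous f x) -> (forall x, continuous g x) ->
  RInt (fun x => u * f x + v * g x) a b = u * RInt f a b + v * RInt g a b.
Proof.
intros Hf Hg. apply is_RInt_unique.
apply (is_RInt_plus (V := R_NormedModule) (fun x => u * f x) (fun x => v * g x)).
- apply (is_RInt_scal (V := R_NormedModule) f a b u), (RInt_correct (V := R_CompleteNormedModule)).
  now apply ex_RInt_everywhere.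
- apply (is_RInt_scal (V := R_NormedModule) g a b v), (RInt_correct (V := R_CompleteNormedModule)).
  now apply ex_RInt_everywhere.
Qed.

(** Orthogonality to all trigonometric monomials, of either sign of frequency
    and with arbitrary phase: in this form it is visibly stable under
    multiplication of [h] by shifted cosines. *)
Definition annihilates_trig (h : R -> R) : Prop :=
  forall (k : Z) a, RInt (fun x => h x * cos (IZR k * x + a)) 0 (2 * PI) = 0.

(** The product of two cosines is half the sum of the cosines of the sum and
    of the difference of the angles, so it stays within the annihilated
    monomials. *)
Lemma annihilates_trig_mult_cos (h : R -> R) c x0 : (forall x, continuous h x) -> annihilates_trig h ->
  annihilates_trig (fun x => h x * (c + cos (x - x0))).
Proof.
intros Hc Ho k a.
assert (E : forall k a x, continuous (fun x => h x * cos (IZR k * x + a)) x).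
{ intros. apply continuous_mult_R; auto. intros; apply continuous_cos_lin. }
rewrite (RInt_ext _ (fun x => c * (h x * cos (IZR k * x + a)) + 1 *
   (/2 * (h x * cos (IZR (k+1) * x + (a - x0))) + /2 * (h x * cos (IZR (k-1) * x + (a + x0)))))).
- rewrite (RInt_linear (fun x => h x * cos (IZR k * x + a))
    (fun x => /2 * (h x * cos (IZR (k+1) * x + (a - x0))) + /2 * (h x * cos (IZR (k-1) * x + (a + x0))))); auto.
  + rewrite (RInt_linear (fun x => h x * cos (IZR (k+1) * x + (a - x0)))
             (fun x => h x * cos (IZR (k-1) * x + (a + x0)))); auto.
    rewrite !Ho; lra.
  + apply continuous_plus_R; apply continuous_mult_R; auto; intros; apply continuous_const.
- intros x _.
  rewrite plus_IZR, minus_IZR.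
  replace ((IZR k + 1) * x + (a - x0)) with ((IZR k * x + a) + (x - x0)) by ring.
  replace ((IZR k - 1) * x + (a + x0)) with ((IZR k * x + a) - (x - x0)) by ring.
  set (u := IZR k * x + a). set (v := x - x0).
  rewrite (cos_plus u v), (cos_minus u v). equation_in_R. field.
Qed.

Lemma annihilates_trig_mult_pow (h : R -> R) c x0 n : (forall x, continuous h x) -> annihilates_trig h ->
  annihilates_trig (fun x => h x * (c + cos (x - x0)) ^ n).
Proof.
intros Hc Ho; induction n as [|n IH].
- intros k a. eapply eq_trans; [|apply (Ho k a)]. apply RInt_ext; intros; simpl. equation_in_R; ring.
- assert (Hn : forall x, continuous (fun x => h x * (c + cos (x - x0)) ^ n) x).
  { apply continuous_mult_R; auto. intros x.
    apply (ex_derive_continuous (fun x => (c + cos (x - x0)) ^ n)). auto_derive. auto. }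
  intros k a. eapply eq_trans; [|apply (annihilates_trig_mult_cos _ c x0 Hn IH k a)].
  apply RInt_ext; intros; simpl. equation_in_R; ring.
Qed.

Lemma cos_outside d u : 0 < d -> d <= PI -> d <= Rabs u <= 2 * PI - d -> cos u <= cos d.
Proof.
intros Hd Hd' Hu.
assert (E : cos u = cos (Rabs u)).
{ unfold Rabs; destruct Rcase_abs; auto. now rewrite cos_neg. }
rewrite E. set (v := Rabs u) in *.
destruct (Rle_dec v PI).
- apply cos_decr_1; lra.
- rewrite <- (cos_neg v). replace (cos (-v)) with (cos (2 * PI - v)).
  + apply cos_decr_1; lra.
  + replace (2*PI - v) with (-v + 2 * INR 1 * PI) by (simpl; ring). apply cos_period.
Qed.

Lemma cos_inside d u : 0 < d -> d <= PI -> Rabs u <= d -> cos d <= cos u.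
Proof.
intros Hd Hd' Hu.
assert (E : cos u = cos (Rabs u)).
{ unfold Rabs; destruct Rcase_abs; auto. now rewrite cos_neg. }
rewrite E. pose proof (Rabs_pos u). apply cos_decr_1; lra.
Qed.

Lemma pow_abs_le1 x n : Rabs x <= 1 -> Rabs (x ^ n) <= 1.
Proof.
intros H; rewrite <- RPow_abs. rewrite <- (pow1 n). apply pow_incr. split; auto. apply Rabs_pos.
Qed.

Lemma bounded_on_segment (h : R -> R) a b : a <= b -> (forall x, continuous h x) ->
  exists M, 0 < M /\ forall x, a <= x <= b -> Rabs (h x) <= M.
Proof.
intros Hab Hc.
destruct (continuity_ab_maj (fun x => Rabs (h x)) a b Hab) as [m [Hm _]].
- intros c _. apply continuity_pt_filterlim.
  apply (continuous_comp h Rabs); auto. apply continuous_Rabs.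
- exists (Rabs (h m) + 1). pose proof (Rabs_pos (h m)). split; [lra|].
  intros x Hx; specialize (Hm x Hx). lra.
Qed.

(** The classical peaking argument. The trigonometric polynomials (1 - cos d +
    cos (x - x0))^n are bounded by 1 in absolute value at distance more than
    [d] from [x0], at least 1 within distance [d], and grow without bound
    within distance d/2. If [h x0 > 0], the integral of [h] against them would
    tend to infinity, but it is 0. *)
Lemma annihilates_trig_not_pos (h : R -> R) : (forall x, continuous h x) -> annihilates_trig h ->
  forall x0, 0 < x0 < 2 * PI -> ~ 0 < h x0.
Proof.
intros Hc Ho x0 Hx0 Hpos.
destruct (bounded_on_segment h 0 (2*PI)) as [M [HM HMb]]; auto.
{ lra. }
assert (Hloc : exists d, 0 < d /\ d <= PI /\ d < x0 /\ d < 2 * PI - x0 /\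
   forall x, Rabs (x - x0) <= d -> h x0 / 2 <= h x).
{ pose proof PI_RGT_0.
  assert (He : 0 < h x0 / 2) by lra.
  destruct (Hc x0 _ (locally_ball (h x0) (mkposreal _ He))) as [d Hd].
  (* Small enough for continuity of [h], for the monotonicity of cosine, and
      to stay inside the period. *)
  pose (d' := Rmin (d/2) (Rmin (PI/2) (Rmin (x0/2) ((2*PI - x0)/2)))).
  assert (D : 0 < d' /\ d' < d /\ d' <= PI /\ d' < x0 /\ d' < 2*PI - x0).
  { pose proof (cond_pos d). unfold d', Rmin; repeat destruct Rle_dec; lra. }
  exists d'; repeat split; try lra. intros x Hx.
  assert (B : ball x0 d x). { change (Rabs (x - x0) < d). lra. }
  specialize (Hd x B). change (Rabs (h x - h x0) < h x0 / 2) in Hd.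
  unfold Rabs in Hd; destruct Rcase_abs in Hd; lra. }
destruct Hloc as (d & Hd0 & Hd1 & Hd2 & Hd3 & Hd).
set (eps := h x0 / 2) in *. assert (He : 0 < eps) by (unfold eps; lra).
set (c := 1 - cos d).
assert (Heta : 0 < cos (d/2) - cos d).
{ assert (cos d < cos (d/2)). apply cos_decreasing_1; lra. lra. }
set (eta := cos (d/2) - cos d) in *.
set (l := x0 - d/2). set (r := x0 + d/2).
assert (key : forall n, d * (eps * (INR n * eta)) <= 2 * PI * M).
{ intros n.
  set (g := fun x => h x * (c + cos (x - x0)) ^ n).
  assert (gc : forall x, continuous g x).
  { apply continuous_mult_R; auto. intros x.
    apply (ex_derive_continuous (fun x => (c + cos (x - x0)) ^ n)). auto_derive. auto. }
  assert (G0 : RInt g 0 (2*PI) = 0).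
  { eapply eq_trans; [|apply (annihilates_trig_mult_pow h c x0 n Hc Ho 0%Z 0)]. apply RInt_ext. intros x _.
    unfold g. replace (0 * x + 0) with 0 by ring. rewrite cos_0. rewrite Rmult_1_r. reflexivity. }
  assert (Hout : forall x, 0 <= x <= 2*PI -> - M <= g x).
  { intros x Hx. unfold g.
    destruct (Rle_dec (Rabs (x - x0)) d) as [Hi|Hi].
    - assert (0 <= h x * (c + cos (x - x0)) ^ n); [|lra].
      apply Rmult_le_pos. specialize (Hd x Hi); lra. apply pow_le.
      pose proof (cos_inside d (x - x0) Hd0 Hd1 Hi). unfold c. lra.
    - assert (Ht : Rabs (c + cos (x - x0)) <= 1).
      { assert (cos (x - x0) <= cos d). apply cos_outside; auto. split; [lra|].
        unfold Rabs; destruct Rcase_abs; lra.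
        pose proof (COS_bound (x - x0)). pose proof (COS_bound d).
        unfold c; apply Rabs_le; lra. }
      assert (Rabs (h x * (c + cos (x - x0)) ^ n) <= M).
      { rewrite Rabs_mult. rewrite <- (Rmult_1_r M). apply Rmult_le_compat; try apply Rabs_pos.
        now apply HMb. now apply pow_abs_le1. }
      apply Rabs_le_between in H. lra. }
  assert (Hin : forall x, l <= x <= r -> eps * (INR n * eta) <= g x).
  { intros x Hx. unfold g.
    assert (Hi : Rabs (x - x0) <= d/2). { unfold l, r in Hx. apply Rabs_le; lra. }
    assert (H2 : cos (d/2) <= cos (x - x0)) by (apply cos_inside; lra).
    assert (H3 : eps <= h x) by (apply Hd; lra).
    assert (H4 : INR n * eta <= (c + cos (x - x0)) ^ n).
    { apply Rle_trans with ((1 + eta) ^ n). pose proof (poly n eta Heta). lra.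
      apply pow_incr. unfold c, eta in *. lra. }
    apply Rmult_le_compat; auto; try lra. apply Rmult_le_pos; [apply pos_INR|lra]. }
  assert (E : forall a b, ex_RInt g a b) by (intros; now apply ex_RInt_everywhere).
  rewrite <- (RInt_Chasles g 0 l (2*PI)) in G0; auto.
  rewrite <- (RInt_Chasles g l r (2*PI)) in G0; auto.
  assert (I1 : RInt (fun _ => - M) 0 l <= RInt g 0 l).
  { apply RInt_le; auto. unfold l; lra. apply ex_RInt_const. intros; apply Hout. unfold l in *; lra. }
  assert (I2 : RInt (fun _ => eps * (INR n * eta)) l r <= RInt g l r).
  { apply RInt_le; auto. unfold l, r; lra. apply ex_RInt_const. intros; apply Hin. lra. }
  assert (I3 : RInt (fun _ => - M) r (2*PI) <= RInt g r (2*PI)).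
  { apply RInt_le; auto. unfold r; lra. apply ex_RInt_const. intros; apply Hout. unfold r in *; lra. }
  rewrite RInt_const in I1. rewrite RInt_const in I2. rewrite RInt_const in I3.
  unfold plus in G0; simpl in G0. unfold scal in *; simpl in *. unfold mult in *; simpl in *.
  unfold l, r in *. nra. }
assert (Hp : 0 < d * (eps * eta)) by (apply Rmult_lt_0_compat; auto; now apply Rmult_lt_0_compat).
destruct (INR_unbounded (2*PI*M / (d * (eps*eta)))) as [n Hn].
specialize (key n).
apply (Rmult_lt_compat_r _ _ _ Hp) in Hn. unfold Rdiv in Hn. rewrite Rmult_assoc, Rinv_l in Hn; lra.
Qed.

(** Interior points are covered by the peaking argument for [h] and [- h]; the
    end points are limits of interior points. *)
Lemma annihilates_trig_zero (h : R -> R) : (forall x, continuous h x) -> annihilates_trig h ->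
  forall x0, 0 <= x0 <= 2 * PI -> h x0 = 0.
Proof.
intros Hc Ho.
assert (Hint : forall x, 0 < x < 2*PI -> h x = 0).
{ intros x Hx.
  assert (H1 := annihilates_trig_not_pos h Hc Ho x Hx).
  assert (H2 : ~ 0 < - h x).
  { apply (annihilates_trig_not_pos (fun x => - h x)); auto.
    - intros y; apply (continuous_opp (V:=R_NormedModule)); auto.
    - intros k a. assert (Hk : forall x, continuous (fun x => h x * cos (IZR k * x + a)) x).
      { apply continuous_mult_R; auto. intros; apply continuous_cos_lin. }
      rewrite (RInt_ext _ (fun x => -1 * (h x * cos (IZR k * x + a)) + 0 * (h x * cos (IZR k * x + a)))).
      rewrite RInt_linear; auto. rewrite Ho; equation_in_R; ring.
      intros; equation_in_R; ring. }
  lra. }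
intros x0 Hx0.
destruct (Req_dec (h x0) 0) as [|Hn]; auto. exfalso.
assert (He : 0 < Rabs (h x0)) by now apply Rabs_pos_lt.
destruct (Hc x0 _ (locally_ball (h x0) (mkposreal _ He))) as [d Hd].
assert (X : exists x, 0 < x < 2*PI /\ Rabs (x - x0) < d).
{ pose proof PI_RGT_0. pose proof (cond_pos d).
  pose (e := Rmin (d/2) (PI/2)).
  assert (0 < e < d /\ e < PI) by (unfold e, Rmin; destruct Rle_dec; lra).
  destruct (Rle_dec x0 PI).
  - exists (x0 + e). split; [lra|]. replace (x0 + e - x0) with e by ring. rewrite Rabs_pos_eq; lra.
  - exists (x0 - e). split; [lra|]. replace (x0 - e - x0) with (-e) by ring. rewrite Rabs_Ropp, Rabs_pos_eq; lra. }
destruct X as (x & Hx & Hxd).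
specialize (Hd x Hxd). change (Rabs (h x - h x0) < Rabs (h x0)) in Hd.
rewrite Hint in Hd; auto. rewrite Rminus_0_l, Rabs_Ropp in Hd. lra.
Qed.

(** * Fourier inversion for absolutely summable series *)

Lemma sum_n_gap (u B : nat -> R) N M : (forall n, Rabs (u n) <= B n) -> (N <= M)%nat ->
  Rabs (sum_n u M - sum_n u N) <= sum_n B M - sum_n B N.
Proof.
intros H HNM; induction HNM as [|M HM IH].
- rewrite !Rminus_diag, Rabs_R0. lra.
- rewrite !sum_Sn. unfold plus; simpl. specialize (H (S M)).
  replace (sum_n u M + u (S M) - sum_n u N) with ((sum_n u M - sum_n u N) + u (S M)) by ring.
  pose proof (Rabs_triang (sum_n u M - sum_n u N) (u (S M))). lra.
Qed.

Lemma ex_series_dominated (u B : nat -> R) : (forall n, Rabs (u n) <= B n) -> ex_series B -> ex_series u.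
Proof. intros H HB; apply (ex_series_le (K:=R_AbsRing) (V:=R_CompleteNormedModule) u B); auto. Qed.

Lemma series_tail (u B : nat -> R) N : (forall n, Rabs (u n) <= B n) -> ex_series B ->
  Rabs (Series u - sum_n u N) <= Series B - sum_n B N.
Proof.
intros H HB.
assert (Hu := ex_series_dominated u B H HB).
apply Series_correct in Hu. apply Series_correct in HB.
assert (L1 : is_lim_seq (fun M => Rabs (sum_n u M - sum_n u N)) (Rabs (Series u - sum_n u N))).
{ apply (is_lim_seq_abs _ (Series u - sum_n u N)).
  apply is_lim_seq_minus'. exact Hu. apply is_lim_seq_const. }
assert (L2 : is_lim_seq (fun M => sum_n B M - sum_n B N) (Series B - sum_n B N)).
{ apply is_lim_seq_minus'. exact HB. apply is_lim_seq_const. }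
apply (is_lim_seq_le_loc _ _ (Finite _) (Finite _)) with (2 := L1) (3 := L2).
exists N; intros M HM. now apply sum_n_gap.
Qed.

Lemma series_tail_lim (B : nat -> R) : ex_series B ->
  is_lim_seq (fun N => Series B - sum_n B N) 0.
Proof.
intros HB; apply Series_correct in HB.
replace (Finite 0) with (Finite (Series B - Series B)) by (f_equal; ring).
apply is_lim_seq_minus'. apply is_lim_seq_const. exact HB.
Qed.

Lemma continuous_sum_n (u : nat -> R -> R) N : (forall n x, continuous (u n) x) ->
  forall x, continuous (fun x => sum_n (fun n => u n x) N) x.
Proof.
intros H; induction N as [|N IH]; intros x.
- apply (continuous_ext (u 0%nat)); auto. intros; now rewrite sum_O.
- apply (continuous_ext (fun x => sum_n (fun n => u n x) N + u (S N) x)).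
  intros; now rewrite sum_Sn. apply continuous_plus_R; auto.
Qed.

Lemma continuous_series (u : nat -> R -> R) (B : nat -> R) :
  (forall n x, Rabs (u n x) <= B n) -> ex_series B -> (forall n x, continuous (u n) x) ->
  forall x, continuous (fun x => Series (fun n => u n x)) x.
Proof.
intros H HB Hc x.
apply (continuous_ext (fun y => real (Lim_seq (fun N => sum_n (fun n => u n y) N)))).
{ intros y. reflexivity. }
apply continuity_pt_filterlim.
apply (CVU_cont_open (fun N y => sum_n (fun n => u n y) N) (fun _ => True)); auto.
- apply open_true.
- intros eps.
  destruct (series_tail_lim B HB (ball 0 eps) (locally_ball 0 eps)) as [N HN].
  exists N; intros n Hn y _. specialize (HN n Hn).
  change (Rabs ((Series B - sum_n B n) - 0) < eps) in HN.
  rewrite Rabs_minus_sym.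
  apply Rle_lt_trans with (1 := series_tail (fun n => u n y) B n (fun n => H n y) HB).
  rewrite Rminus_0_r in HN. apply Rle_lt_trans with (2 := HN). apply Rle_abs.
- intros n y _. apply continuity_pt_filterlim. now apply continuous_sum_n.
Qed.

(** Meant for Fourier coefficients of a dominated series: [g] will be a
    trigonometric monomial. *)
Lemma RInt_series (u : nat -> R -> R) (B : nat -> R) g a b l :
  a <= b ->
  (forall n x, Rabs (u n x) <= B n) -> ex_series B -> (forall n x, continuous (u n) x) ->
  (forall x, continuous g x) -> (forall x, Rabs (g x) <= 1) ->
  is_series (fun n => RInt (fun x => u n x * g x) a b) l ->
  RInt (fun x => Series (fun n => u n x) * g x) a b = l.
Proof.
intros Hab H HB Hc Hg Hg1 Hl.
set (S := fun x => Series (fun n => u n x)).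
assert (Sc : forall x, continuous S x) by (now apply (continuous_series u B)).
assert (fin : forall N, RInt (fun x => sum_n (fun n => u n x) N * g x) a b =
   sum_n (fun n => RInt (fun x => u n x * g x) a b) N).
{ induction N as [|N IH].
  - rewrite sum_O. apply RInt_ext; intros; now rewrite sum_O.
  - rewrite sum_Sn, <- IH. unfold plus; simpl.
    rewrite (RInt_ext _ (fun x => 1 * (sum_n (fun n => u n x) N * g x) + 1 * (u (Datatypes.S N) x * g x))).
    + rewrite RInt_linear. equation_in_R; ring.
      apply continuous_mult_R; auto. now apply continuous_sum_n. apply continuous_mult_R; auto.
    + intros; rewrite sum_Sn; unfold plus; simpl; equation_in_R; ring. }
assert (L : is_lim_seq (fun N => RInt (fun x => sum_n (fun n => u n x) N * g x) a b)
   (RInt (fun x => S x * g x) a b)).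
{ apply is_lim_seq_spec. intros eps.
  assert (Hb : 0 < b - a + 1) by lra.
  assert (He : 0 < eps / (b - a + 1)) by (apply Rdiv_lt_0_compat; auto; apply eps).
  destruct (series_tail_lim B HB (ball 0 (mkposreal _ He)) (locally_ball _ _)) as [N HN].
  exists N; intros n Hn. specialize (HN n Hn).
  change (Rabs ((Series B - sum_n B n) - 0) < eps / (b - a + 1)) in HN.
  rewrite Rminus_0_r in HN. apply Rabs_lt_between in HN.
  assert (Snc : forall x, continuous (fun x => sum_n (fun n => u n x) n * g x) x).
  { apply continuous_mult_R; auto. now apply continuous_sum_n. }
  assert (E : RInt (fun x => sum_n (fun n => u n x) n * g x) a b - RInt (fun x => S x * g x) a b =
     RInt (fun x => (sum_n (fun n => u n x) n - S x) * g x) a b).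
  { rewrite (RInt_ext (fun x => (sum_n (fun n => u n x) n - S x) * g x)
      (fun x => 1 * (sum_n (fun n => u n x) n * g x) + (-1) * (S x * g x))).
    rewrite RInt_linear; auto. equation_in_R; ring. now apply continuous_mult_R. intros; equation_in_R; ring. }
  rewrite E.
  apply Rle_lt_trans with ((b - a) * (Series B - sum_n B n)).
  - apply abs_RInt_le_const; auto.
    + apply ex_RInt_everywhere, continuous_mult_R; auto.
      intros x. apply (continuous_minus (V:=R_NormedModule)); auto. now apply continuous_sum_n.
    + intros x _. rewrite Rabs_mult. rewrite <- (Rmult_1_r (Series B - _)).
      apply Rmult_le_compat; auto; try apply Rabs_pos.
      rewrite Rabs_minus_sym. now apply (series_tail (fun n => u n x) B n).
  - apply Rle_lt_trans with ((b - a) * (eps / (b - a + 1))).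
    + apply Rmult_le_compat_l; lra.
    + apply Rlt_le_trans with ((b - a + 1) * (eps / (b - a + 1))).
      apply Rmult_lt_compat_r; lra. right; field; lra. }
assert (L' : is_lim_seq (fun N => RInt (fun x => sum_n (fun n => u n x) N * g x) a b) l).
{ apply is_lim_seq_ext with (sum_n (fun n => RInt (fun x => u n x * g x) a b)); auto. }
apply is_lim_seq_unique in L. apply is_lim_seq_unique in L'. rewrite L in L'. now injection L'.
Qed.

Lemma is_series_single (a : nat -> R) k : (forall n, n <> k -> a n = 0) -> is_series a (a k).
Proof.
intros H.
assert (Hlt : forall N, (N < k)%nat -> sum_n a N = 0).
{ induction N as [|N IH]; intros HN.
  rewrite sum_O. apply H; lia. rewrite sum_Sn, IH, H by lia. unfold plus; simpl; equation_in_R; ring. }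
assert (Hge : forall N, (k <= N)%nat -> sum_n a N = a k).
{ induction N as [|N IH]; intros HN.
  - rewrite sum_O. f_equal; lia.
  - rewrite sum_Sn. destruct (Nat.eq_dec k (S N)) as [->|].
    rewrite Hlt by lia. unfold plus; simpl; equation_in_R; ring.
    rewrite IH, (H (S N)) by lia. unfold plus; simpl; equation_in_R; ring. }
change (is_lim_seq (sum_n a) (a k)).
apply (is_lim_seq_ext_loc (fun _ => a k)).
exists k; intros; now rewrite Hge. apply is_lim_seq_const.
Qed.

Lemma RInt_cos_period (j : Z) g : j <> 0%Z -> RInt (fun x => cos (IZR j * x + g)) 0 (2*PI) = 0.
Proof.
intros Hj. assert (IZR j <> 0) by (now apply eq_IZR_contrapositive).
apply is_RInt_unique.
replace 0 with (minus (sin (IZR j * (2*PI) + g) / IZR j) (sin (IZR j * 0 + g) / IZR j)) at 2.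
- apply (is_RInt_derive (V:=R_CompleteNormedModule) (fun x => sin (IZR j * x + g) / IZR j)).
  + intros x _. auto_derive; auto. now field.
  + intros x _. apply continuous_cos_lin.
- unfold minus, plus, opp; simpl.
  replace (sin (IZR j * (2 * PI) + g)) with (sin (IZR j * 0 + g)). ring.
  replace (IZR j * (2*PI) + g) with (g + 2 * IZR j * PI) by ring.
  replace (IZR j * 0 + g) with g by ring.
  destruct (Z.le_gt_cases 0 j).
  + rewrite <- (Z2Nat.id j) by auto. rewrite <- INR_IZR_INZ. now rewrite sin_period.
  + rewrite <- (sin_period (g + 2 * IZR j * PI) (Z.to_nat (-j))).
    rewrite INR_IZR_INZ, Z2Nat.id by lia. f_equal. rewrite opp_IZR. ring.
Qed.

Lemma RInt_cos_period0 g : RInt (fun x => cos (IZR 0 * x + g)) 0 (2*PI) = 2 * PI * cos g.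
Proof.
rewrite (RInt_ext _ (fun _ => cos g)).
- rewrite RInt_const. unfold scal; simpl; unfold mult; simpl. equation_in_R; ring.
- intros; f_equal; ring.
Qed.

(** The constant term of a Fourier series is half the coefficient of order 0.
    *)
Definition mean_weight (n : nat) : R := match n with O => / 2 | S _ => 1 end.

Definition fourier_term (f : R -> R) (n : nat) (x : R) : R :=
  mean_weight n * fourier_cos f n * cos (INR n * x) + fourier_sin f n * sin (INR n * x).

Lemma fourier_term_bound f n x :
  Rabs (fourier_term f n x) <= Rabs (fourier_cos f n) + Rabs (fourier_sin f n).
Proof.
unfold fourier_term. eapply Rle_trans; [apply Rabs_triang|].
apply Rplus_le_compat; rewrite Rabs_mult.
- rewrite Rabs_mult. 
  assert (Rabs (mean_weight n) <= 1). { destruct n; simpl; rewrite Rabs_pos_eq; lra. }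
  assert (Rabs (cos (INR n * x)) <= 1). { apply Rabs_le, COS_bound. }
  rewrite <- (Rmult_1_r (Rabs (fourier_cos f n))) at 2.
  apply Rmult_le_compat; auto; try apply Rabs_pos. apply Rmult_le_pos; apply Rabs_pos.
  rewrite <- (Rmult_1_l (Rabs (fourier_cos f n))) at 2.
  apply Rmult_le_compat_r; auto. apply Rabs_pos.
- assert (Rabs (sin (INR n * x)) <= 1). { apply Rabs_le, SIN_bound. }
  rewrite <- (Rmult_1_r (Rabs (fourier_sin f n))) at 2.
  apply Rmult_le_compat_l; auto. apply Rabs_pos.
Qed.

Lemma fourier_term_continuous f n x : continuous (fourier_term f n) x.
Proof.
apply (ex_derive_continuous (fourier_term f n)). unfold fourier_term. auto_derive. auto.
Qed.

(** Orthogonality of the trigonometric system, with a phase [al] that covers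
    sines and cosines at once. *)
Lemma RInt_trig_cos A b n k al :
  RInt (fun x => (A * cos (INR n * x) + b * sin (INR n * x)) * cos (INR k * x + al)) 0 (2*PI) =
  if Nat.eq_dec n k then (match n with O => 2 * PI * A * cos al
                                     | S _ => PI * (A * cos al - b * sin al) end) else 0.
Proof.
set (J := fun (j : Z) g => RInt (fun x => cos (IZR j * x + g)) 0 (2*PI)).
assert (E : RInt (fun x => (A * cos (INR n * x) + b * sin (INR n * x)) * cos (INR k * x + al)) 0 (2*PI)
  = A / 2 * (J (Z.of_nat n + Z.of_nat k)%Z al + J (Z.of_nat n - Z.of_nat k)%Z (- al)) +
    b / 2 * (J (Z.of_nat n + Z.of_nat k)%Z (al - PI/2) + J (Z.of_nat n - Z.of_nat k)%Z (- al - PI/2))).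
{ rewrite (RInt_ext _ (fun x =>
     A / 2 * (1 * cos (IZR (Z.of_nat n + Z.of_nat k) * x + al) + 1 * cos (IZR (Z.of_nat n - Z.of_nat k) * x + - al)) +
     b / 2 * (1 * cos (IZR (Z.of_nat n + Z.of_nat k) * x + (al - PI/2)) + 1 * cos (IZR (Z.of_nat n - Z.of_nat k) * x + (- al - PI/2))))).
  - rewrite RInt_linear.
    + rewrite !RInt_linear; try (intros; apply continuous_cos_lin). unfold J. equation_in_R; ring.
    + apply continuous_plus_R; apply continuous_mult_R; intros; try apply continuous_const; apply continuous_cos_lin.
    + apply continuous_plus_R; apply continuous_mult_R; intros; try apply continuous_const; apply continuous_cos_lin.
  - intros x _. rewrite plus_IZR, minus_IZR, <- !INR_IZR_INZ.
    set (u := INR n * x). set (v := INR k * x + al).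
    replace ((INR n + INR k) * x + al) with (u + v) by (unfold u, v; ring).
    replace ((INR n - INR k) * x + - al) with (u - v) by (unfold u, v; ring).
    replace ((INR n + INR k) * x + (al - PI/2)) with (-(PI/2 - (u + v))) by (unfold u, v; ring).
    replace ((INR n - INR k) * x + (- al - PI/2)) with (-(PI/2 - (u - v))) by (unfold u, v; ring).
    rewrite !cos_neg, !cos_shift, cos_plus, cos_minus, sin_plus, sin_minus. equation_in_R; field. }
rewrite E; clear E. unfold J.
destruct (Nat.eq_dec n k) as [<-|Hnk].
- rewrite Z.sub_diag, !RInt_cos_period0.
  replace (cos (- al - PI/2)) with (- sin al).
  2:{ rewrite <- cos_neg. replace (- (- al - PI/2)) with (PI/2 + al) by ring. rewrite cos_plus, cos_PI2, sin_PI2; ring. }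
  rewrite (cos_neg al).
  destruct n as [|n].
  + simpl (Z.of_nat 0 + Z.of_nat 0)%Z. rewrite !RInt_cos_period0.
    replace (cos (al - PI/2)) with (sin al).
    2:{ rewrite cos_minus, cos_PI2, sin_PI2; ring. }
    equation_in_R; field.
  + rewrite !RInt_cos_period by lia. equation_in_R; field.
- rewrite !RInt_cos_period by lia. equation_in_R; ring.
Qed.

(** The sum of the Fourier series is continuous by domination, and has the
    same Fourier coefficients as [f]; their difference is annihilated by all
    monomials, hence vanishes on the whole segment, end points included. In
    particular a continuous [f] with summable coefficients satisfies [f 0 = f
    (2 * PI)]. *)
Theorem fourier_inversion_cont (f : R -> R) : (forall x, continuous f x) -> fourier_abs_summable f ->
  forall x, interval 0 (2*PI) x -> is_series (fun n => fourier_term f n x) (f x).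
Proof.
intros Hc Hs.
set (B := fun n => Rabs (fourier_cos f n) + Rabs (fourier_sin f n)).
set (S := fun x => Series (fun n => fourier_term f n x)).
assert (Sc : forall x, continuous S x).
{ apply (continuous_series (fourier_term f) B); auto.
  apply fourier_term_bound. apply fourier_term_continuous. }
assert (Hfk : forall k al, RInt (fun x => f x * cos (INR k * x + al)) 0 (2*PI) =
   PI * (fourier_cos f k * cos al - fourier_sin f k * sin al)).
{ intros k al. pose proof PI_RGT_0.
  rewrite (RInt_ext _ (fun x => cos al * (f x * cos (INR k * x)) + (- sin al) * (f x * sin (INR k * x)))).
  - rewrite RInt_linear. unfold fourier_cos, fourier_sin. equation_in_R; field; lra.
    apply continuous_mult_R; auto. intros; apply continuous_cos_mul.
    apply continuous_mult_R; auto. intros; apply continuous_sin_mul.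
  - intros x _. rewrite cos_plus. equation_in_R; ring. }
assert (HSk : forall k al, RInt (fun x => S x * cos (INR k * x + al)) 0 (2*PI) =
   PI * (fourier_cos f k * cos al - fourier_sin f k * sin al)).
{ intros k al. pose proof PI_RGT_0.
  apply (RInt_series (fourier_term f) B); auto.
  - lra.
  - apply fourier_term_bound.
  - apply fourier_term_continuous.
  - intros; apply continuous_cos_lin.
  - intros; apply Rabs_le, COS_bound.
  - set (I := fun n => RInt (fun x => fourier_term f n x * cos (INR k * x + al)) 0 (2 * PI)).
    assert (HI : I k = PI * (fourier_cos f k * cos al - fourier_sin f k * sin al)).
    { unfold I, fourier_term. cbv beta. rewrite RInt_trig_cos.
      destruct (Nat.eq_dec k k) as [_|]; [|lia].
      destruct k; unfold mean_weight.
      + replace (fourier_sin f 0) with 0. equation_in_R; field. unfold fourier_sin.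
        rewrite (RInt_ext _ (fun _ => 0)). rewrite RInt_const. unfold scal; simpl; unfold mult; simpl. equation_in_R; ring.
        intros. simpl. rewrite Rmult_0_l, sin_0. equation_in_R; ring.
      + equation_in_R; ring. }
    rewrite <- HI. apply is_series_single. intros n Hn. unfold I, fourier_term.
    rewrite RInt_trig_cos. now destruct (Nat.eq_dec n k). }
set (h := fun x => f x - S x).
assert (hc : forall x, continuous h x) by (intros x; apply (continuous_minus (V:=R_NormedModule)); auto).
assert (hk : forall k al, RInt (fun x => h x * cos (INR k * x + al)) 0 (2*PI) = 0).
{ intros k al.
  rewrite (RInt_ext _ (fun x => 1 * (f x * cos (INR k * x + al)) + (-1) * (S x * cos (INR k * x + al)))).
  - rewrite (RInt_linear (fun x => f x * cos (INR k * x + al)) (fun x => S x * cos (INR k * x + al))).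
    + rewrite Hfk, HSk. equation_in_R; ring.
    + apply continuous_mult_R; auto; intros; apply continuous_cos_lin.
    + apply continuous_mult_R; auto; intros; apply continuous_cos_lin.
  - intros; unfold h; equation_in_R; ring. }
assert (ho : annihilates_trig h).
{ intros k al. destruct (Z.le_gt_cases 0 k).
  - eapply eq_trans; [|apply (hk (Z.to_nat k) al)].
    rewrite INR_IZR_INZ, Z2Nat.id; auto.
  - eapply eq_trans; [|apply (hk (Z.to_nat (- k)) (- al))]. apply RInt_ext; intros x _.
    rewrite INR_IZR_INZ, Z2Nat.id by lia. rewrite opp_IZR, <- (cos_neg (IZR k * x + al)).
    f_equal. f_equal. ring. }
intros x Hx.
assert (E := annihilates_trig_zero h hc ho x Hx). unfold h in E.
replace (f x) with (S x) by lra.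
apply Series_correct. apply (ex_series_dominated _ B); auto. intros; apply fourier_term_bound.
Qed.

(** Fourier coefficients see only the values on the segment, so [f] may be
    replaced by its continuous extension that is constant outside the segment.
    *)
Theorem fourier_inversion (f : R -> R) : continuous_on (interval 0 (2*PI)) f -> fourier_abs_summable f ->
  forall x, interval 0 (2*PI) x -> is_series (fun n => fourier_term f n x) (f x).
Proof.
intros Hc Hs x Hx. pose proof PI_RGT_0.
set (g := fun x => f (clamp 0 (2*PI) x)).
assert (Eg : forall x, interval 0 (2*PI) x -> g x = f x).
{ intros y Hy; unfold g; now rewrite clamp_id. }
assert (Ecos : forall n, fourier_cos g n = fourier_cos f n).
{ intros; unfold fourier_cos; f_equal; apply RInt_ext. intros y Hy. rewrite Eg; auto.
  unfold interval. rewrite Rmin_left, Rmax_right in Hy; lra. }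
assert (Esin : forall n, fourier_sin g n = fourier_sin f n).
{ intros; unfold fourier_sin; f_equal; apply RInt_ext. intros y Hy. rewrite Eg; auto.
  unfold interval. rewrite Rmin_left, Rmax_right in Hy; lra. }
rewrite <- Eg; auto.
apply (is_series_ext (fun n => fourier_term g n x)).
{ intros n; unfold fourier_term; now rewrite Ecos, Esin. }
apply fourier_inversion_cont; auto.
- apply continuous_clamp_ext; auto. lra.
- unfold fourier_abs_summable. eapply ex_series_ext; [|exact Hs].
  intros n; simpl. now rewrite Ecos, Esin.
Qed.

(** * Trigonometric expansions of the two coordinates *)

Lemma ex_series_inv_sq (u : nat -> R) K :
  (forall n, Rabs (u (S n)) <= K * / (INR (S n) * INR (S n))) -> ex_series u.
Proof.
intros H. apply (ex_series_incr_1 u).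
assert (K0 : 0 <= K).
{ specialize (H 0%nat). simpl in H. rewrite Rmult_1_l, Rinv_1, Rmult_1_r in H.
  pose proof (Rabs_pos (u 1%nat)); lra. }
apply ex_series_dominated with (fun n => 2 * K * (/ INR (S n) - / INR (S (S n)))).
- intros n. apply Rle_trans with (1 := H n).
  rewrite (S_INR (S n)). set (x := INR (S n)).
  (* Comparison with a telescoping series: 1/x^2 <= 2 (1/x - 1/(x+1)) for x >=
      1. *)
  assert (1 <= x) by (unfold x; rewrite S_INR; pose proof (pos_INR n); lra).
  replace (2 * K * (/ x - / (x + 1))) with (K * (2 * / (x * (x + 1)))) by (field; lra).
  apply Rmult_le_compat_l; auto.
  replace (2 * / (x * (x + 1))) with (/ (x * (x + 1) / 2)) by (field; lra).
  apply Rinv_le_contravar; nra.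
- apply (ex_series_scal_l (2 * K) (fun n => / INR (S n) - / INR (S (S n)))). exists 1.
  change (is_lim_seq (sum_n (fun n => / INR (S n) - / INR (S (S n)))) 1).
  apply is_lim_seq_ext with (fun N => 1 - / INR (S (S N))).
  + induction n as [|n IH].
    * rewrite sum_O. simpl. lra.
    * rewrite sum_Sn, <- IH. unfold plus; simpl (_ + _). equation_in_R. 
      change (1 - / INR (S (S (S n))) = 1 - / INR (S (S n)) + (/ INR (S (S n)) - / INR (S (S (S n))))). ring.
  + replace (Finite 1) with (Finite (1 - 0)) by (f_equal; ring).
    apply is_lim_seq_minus'; [apply is_lim_seq_const|].
    apply (is_lim_seq_incr_1 (fun n => / INR (S n))).
    apply (is_lim_seq_incr_1 (fun n => / INR n)).
    replace (Finite 0) with (Rbar_inv p_infty) by reflexivity.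
    apply is_lim_seq_inv. apply is_lim_seq_INR. discriminate.
Qed.

Lemma continuous_triangle x : continuous (fun x => Rabs (PI - x)) x.
Proof.
apply (continuous_comp (fun x => PI - x) Rabs).
apply (continuous_minus (V:=R_NormedModule)); [apply continuous_const|apply continuous_id].
apply continuous_Rabs.
Qed.

Lemma RInt_triangle (g G1 G2 : R -> R) : (forall x, continuous g x) ->
  (forall x, is_derive G1 x ((PI - x) * g x)) ->
  (forall x, is_derive G2 x ((x - PI) * g x)) ->
  RInt (fun x => Rabs (PI - x) * g x) 0 (2*PI) = G1 PI - G1 0 + (G2 (2*PI) - G2 PI).
Proof.
intros Hg H1 H2. pose proof PI_RGT_0.
apply is_RInt_unique. apply (is_RInt_Chasles (V:=R_NormedModule) _ 0 PI (2*PI)).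
- apply (is_RInt_ext (V:=R_NormedModule) (fun x => (PI - x) * g x)).
  + intros x Hx. rewrite Rmin_left, Rmax_right in Hx by lra. rewrite Rabs_pos_eq; lra.
  + apply (is_RInt_derive (V:=R_CompleteNormedModule)); auto.
    intros x _. apply continuous_mult_R; auto. intros y.
    apply (continuous_minus (V:=R_NormedModule)); [apply continuous_const|apply continuous_id].
- apply (is_RInt_ext (V:=R_NormedModule) (fun x => (x - PI) * g x)).
  + intros x Hx. rewrite Rmin_left, Rmax_right in Hx by lra. rewrite Rabs_left; [equation_in_R; ring|lra].
  + apply (is_RInt_derive (V:=R_CompleteNormedModule)); auto.
    intros x _. apply continuous_mult_R; auto. intros y.
    apply (continuous_minus (V:=R_NormedModule)); [apply continuous_id|apply continuous_const].
Qed.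

(** The triangle wave is Lipschitz with one corner, so two integrations by
    parts give coefficients of order 1/n^2. *)
Lemma triangle_summable : fourier_abs_summable (fun x => Rabs (PI - x)).
Proof.
pose proof PI_RGT_0. assert (HP : 3 < PI) by (pose proof PI2_3_2; lra).
apply ex_series_inv_sq with 4. intros n.
assert (Hn : 0 < INR (S n)) by (apply lt_0_INR; lia).
assert (EC : fourier_cos (fun x => Rabs (PI - x)) (S n) =
  / PI * (2 * (1 - cos (INR (S n) * PI)) * / (INR (S n) * INR (S n)))).
{ unfold fourier_cos. f_equal. set (k := INR (S n)) in *.
  rewrite (RInt_triangle (fun x => cos (k * x))
    (fun x => (PI - x) * sin (k * x) / k - cos (k * x) / (k*k))
    (fun x => (x - PI) * sin (k * x) / k + cos (k * x) / (k*k))).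
  - replace (k * (2 * PI)) with (0 + 2 * INR (S n) * PI) by (unfold k; ring).
    rewrite sin_period, cos_period, Rmult_0_r, sin_0, cos_0. equation_in_R; field. lra.
  - intros; apply continuous_cos_mul.
  - intros x. auto_derive; auto. equation_in_R; field. lra.
  - intros x. auto_derive; auto. equation_in_R; field. lra. }
assert (ES : fourier_sin (fun x => Rabs (PI - x)) (S n) = 0).
{ unfold fourier_sin. set (k := INR (S n)) in *.
  rewrite (RInt_triangle (fun x => sin (k * x))
    (fun x => - (PI - x) * cos (k * x) / k - sin (k * x) / (k*k))
    (fun x => - (x - PI) * cos (k * x) / k + sin (k * x) / (k*k))).
  - replace (k * (2 * PI)) with (0 + 2 * INR (S n) * PI) by (unfold k; ring).
    rewrite sin_period, cos_period, Rmult_0_r, sin_0, cos_0. 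
    replace (sin (k * PI)) with 0. equation_in_R; field. lra.
    symmetry; apply sin_eq_0_1. exists (Z.of_nat (S n)). unfold k. now rewrite INR_IZR_INZ.
  - intros; apply continuous_sin_mul.
  - intros x. auto_derive; auto. equation_in_R; field. lra.
  - intros x. auto_derive; auto. equation_in_R; field. lra. }
rewrite ES, EC, Rabs_R0, Rplus_0_r, Rabs_Rabsolu, <- Rmult_assoc.
set (i := / (INR (S n) * INR (S n))).
assert (0 < i) by (apply Rinv_0_lt_compat; nra).
pose proof (COS_bound (INR (S n) * PI)).
assert (Hi : 0 < / PI <= 1).
{ split; [now apply Rinv_0_lt_compat|]. rewrite <- Rinv_1. apply Rinv_le_contravar; lra. }
rewrite Rabs_pos_eq.
- apply Rmult_le_compat_r; [lra|nra].
- apply Rmult_le_pos; [nra|lra].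
Qed.

(** Inserting three zeros after each term: the partial sums of the sparse
    series are those of the original one, each repeated four times. *)
Lemma is_series_sparse (a : nat -> R) l : is_series a l ->
  is_series (fun m => if Nat.eq_dec (m mod 4) 0 then a (m / 4)%nat else 0) l.
Proof.
intros H.
set (b := fun m => if Nat.eq_dec (m mod 4) 0 then a (m / 4)%nat else 0).
assert (E : forall m, sum_n a (m / 4) = sum_n b m).
{ induction m as [|m IH].
  - simpl. rewrite !sum_O. reflexivity.
  - rewrite (sum_Sn b), <- IH. unfold b.
    pose proof (Nat.div_mod_eq m 4). pose proof (Nat.div_mod_eq (S m) 4).
    pose proof (Nat.mod_upper_bound m 4). pose proof (Nat.mod_upper_bound (S m) 4).
    destruct Nat.eq_dec as [e|e].
    + assert (Q : (S m / 4 = S (m / 4))%nat) by lia. rewrite Q, sum_Sn. reflexivity.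
    + assert (Q : (S m / 4 = m / 4)%nat) by lia. rewrite Q.
      symmetry; apply Rplus_0_r. }
change (is_lim_seq (sum_n b) l).
apply is_lim_seq_ext with (1 := E).
apply (filterlim_comp _ _ _ (fun m => (m / 4)%nat) (sum_n a) _ eventually); auto.
intros P [N HN]. exists (4 * N)%nat. intros n Hn. apply HN.
apply Nat.div_le_lower_bound; lia.
Qed.

Lemma is_lim_seq_sparse (a : nat -> R) : is_lim_seq a 0 ->
  is_lim_seq (fun m => if Nat.eq_dec (m mod 4) 0 then a (m / 4)%nat else 0) 0.
Proof.
intros H. apply is_lim_seq_spec in H. apply is_lim_seq_spec. intros eps.
destruct (H eps) as [N HN]. exists (4 * N)%nat. intros n Hn. cbv beta.
destruct Nat.eq_dec.
- apply HN. apply Nat.div_le_lower_bound; lia.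
- rewrite Rminus_0_r, Rabs_R0. apply cond_pos.
Qed.

(** Only convergence and the decay of the coefficients are kept from Fourier
    analysis: decay makes the successive steps of the linkage small. *)
Definition trig_expansion (D : R -> Prop) (g : R -> R) (al be : nat -> R) : Prop :=
  is_lim_seq al 0 /\ is_lim_seq be 0 /\
  forall x, D x -> is_series (fun n => al n * cos (INR n * x) + be n * sin (INR n * x)) (g x).

Lemma trig_expansion_fourier f : continuous_on (interval 0 (2*PI)) f -> fourier_abs_summable f ->
  exists al be, trig_expansion (interval 0 (2*PI)) f al be.
Proof.
intros Hc Hs. exists (fun n => mean_weight n * fourier_cos f n), (fourier_sin f).
pose proof (ex_series_lim_0 _ Hs) as L.
repeat split.
- apply (is_lim_seq_abs_0 (fun n => mean_weight n * fourier_cos f n)).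
  apply is_lim_seq_le_le with (fun _ => 0) (fun n => Rabs (fourier_cos f n) + Rabs (fourier_sin f n)); auto.
  + intros n. split. apply Rabs_pos. rewrite Rabs_mult.
    assert (Rabs (mean_weight n) <= 1). { destruct n; simpl; rewrite Rabs_pos_eq; lra. }
    pose proof (Rabs_pos (fourier_cos f n)). pose proof (Rabs_pos (fourier_sin f n)).
    pose proof (Rabs_pos (mean_weight n)). nra.
  + apply is_lim_seq_const.
- apply (is_lim_seq_abs_0 (fourier_sin f)).
  apply is_lim_seq_le_le with (fun _ => 0) (fun n => Rabs (fourier_cos f n) + Rabs (fourier_sin f n)); auto.
  + intros n. split. apply Rabs_pos. pose proof (Rabs_pos (fourier_cos f n)). lra.
  + apply is_lim_seq_const.
- intros x Hx. now apply fourier_inversion.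
Qed.

(** Since cos (n (4 x - pi)) = (-1)^n cos (4 n x), and likewise for sines, the
    expansion in the variable [4 x - PI] is one in [x] with frequencies
    divisible by 4. *)
Lemma trig_expansion_stretch f al be :
  trig_expansion (interval 0 (2*PI)) f al be ->
  exists al' be', trig_expansion (interval (PI/4) (3*PI/4)) (fun x => f (4 * x - PI)) al' be'.
Proof.
intros (La & Lb & H).
pose (sg := fun n => (-1) ^ n).
assert (sg1 : forall n, Rabs (sg n) = 1) by (intros; unfold sg; apply pow_1_abs).
assert (Hsg : forall u, is_lim_seq u 0 -> is_lim_seq (fun n => sg n * u n) 0).
{ intros u Hu. apply (is_lim_seq_abs_0 (fun n => sg n * u n)).
  apply is_lim_seq_ext with (fun n => Rabs (u n)).
  intros; now rewrite Rabs_mult, sg1, Rmult_1_l. now apply (is_lim_seq_abs_0 u). }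
assert (Hcs : forall n, cos (INR n * PI) = sg n /\ sin (INR n * PI) = 0).
{ induction n as [|n [IH1 IH2]].
  - simpl. rewrite Rmult_0_l, cos_0, sin_0. auto.
  - rewrite S_INR, Rmult_plus_distr_r, Rmult_1_l, neg_cos, neg_sin, IH1, IH2. unfold sg; simpl. lra. }
exists (fun m => if Nat.eq_dec (m mod 4) 0 then sg (m/4)%nat * al (m/4)%nat else 0),
  (fun m => if Nat.eq_dec (m mod 4) 0 then sg (m/4)%nat * be (m/4)%nat else 0).
repeat split.
- apply (is_lim_seq_sparse (fun n => sg n * al n)); auto.
- apply (is_lim_seq_sparse (fun n => sg n * be n)); auto.
- intros x Hx.
  assert (Hx' : interval 0 (2*PI) (4 * x - PI)) by (unfold interval in *; lra).
  specialize (H _ Hx'). apply is_series_sparse in H.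
  eapply is_series_ext; [|exact H]. intros m; cbv beta.
  pose proof (Nat.div_mod_eq m 4). destruct Nat.eq_dec as [e|e]; [|equation_in_R; ring].
  assert (Em : INR m = 4 * INR (m/4)).
  { rewrite H0 at 1. rewrite e, Nat.add_0_r, mult_INR. simpl. ring. }
  set (n := (m/4)%nat) in *. rewrite Em.
  replace (INR n * (4 * x - PI)) with (4 * INR n * x - INR n * PI) by ring.
  destruct (Hcs n) as [C S]. rewrite cos_minus, sin_minus, C, S. equation_in_R; ring.
Qed.

(** On the arc |pi - x| equals pi - x, so 4 x - pi = 3 pi - 4 |pi - x|, and
    the triangle wave can be expanded. *)
Lemma trig_expansion_linear : exists al be,
  trig_expansion (interval (PI/4) (3*PI/4)) (fun x => 4 * x - PI) al be.
Proof.
pose proof PI_RGT_0.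
destruct (trig_expansion_fourier (fun x => Rabs (PI - x))) as (al & be & La & Lb & H1).
- apply continuous_everywhere_on. apply continuous_triangle.
- apply triangle_summable.
- set (d := fun n : nat => match n with O => 3 * PI | S _ => 0 end).
  assert (Ld : is_lim_seq d 0).
  { apply is_lim_seq_ext_loc with (fun _ => 0).
    exists 1%nat; intros [|n] Hn; [lia|reflexivity]. apply is_lim_seq_const. }
  exists (fun n => d n + (-4) * al n), (fun n => (-4) * be n).
  repeat split.
  + replace (Finite 0) with (Finite (0 + (-4) * 0)) by (f_equal; ring).
    apply is_lim_seq_plus'; auto. apply is_lim_seq_mult'; auto. apply is_lim_seq_const.
  + replace (Finite 0) with (Finite ((-4) * 0)) by (f_equal; ring).
    apply is_lim_seq_mult'; auto. apply is_lim_seq_const.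
  + intros x Hx.
    assert (Hx' : interval 0 (2*PI) x) by (unfold interval in *; lra).
    specialize (H1 x Hx').
    assert (Hd : is_series d (3 * PI)).
    { apply (is_series_single d 0). intros [|n] Hn; [lia|reflexivity]. }
    apply (is_series_scal_l (-4)) in H1.
    pose proof (is_series_plus _ _ _ _ Hd H1) as H2.
    replace (4 * x - PI) with (plus (3 * PI) (-4 * Rabs (PI - x))).
    * eapply is_series_ext; [|exact H2]. intros n. unfold plus, scal; cbn -[INR]; unfold mult; cbn -[INR].
      destruct n; unfold d;
        [change (INR 0) with 0; rewrite Rmult_0_l, cos_0, sin_0|]; equation_in_R; ring.
    * rewrite Rabs_pos_eq. unfold plus; simpl; equation_in_R; ring. unfold interval in Hx; lra.
Qed.

(** * Plane geometry of rigid attachments *)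

Definition nsq (v : C) : R := fst v * fst v + snd v * snd v.
Definition det (v w : C) : R := fst v * snd w - snd v * fst w.

Lemma sum_sq_0 x y : x * x + y * y = 0 -> x = 0 /\ y = 0.
Proof. exact (Rplus_sqr_eq_0 x y). Qed.

Lemma nsq_pos v : 0 <= nsq v.
Proof. unfold nsq. nra. Qed.

Lemma nsq_eq_0 v w : nsq (v - w)%C = 0 -> v = w.
Proof.
destruct v as [a b], w as [c d]; unfold nsq; simpl; intros H.
apply sum_sq_0 in H as []; f_equal; lra.
Qed.

Lemma nsq_mult v w : nsq (v * w)%C = nsq v * nsq w.
Proof. destruct v, w; unfold nsq; simpl; ring. Qed.

Lemma dist_nsq (P Q : C) : Defs.dist P Q = sqrt (nsq (P - Q)%C).
Proof. destruct P, Q; unfold Defs.dist, dist_euc, nsq, Rsqr; reflexivity. Qed.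

Lemma dist_eq_nsq (P Q P' Q' : C) : Defs.dist P Q = Defs.dist P' Q' <-> nsq (P - Q)%C = nsq (P' - Q')%C.
Proof.
rewrite !dist_nsq; split; intros H; [|now rewrite H].
apply sqrt_inj; auto; apply nsq_pos.
Qed.

(** Distances to [A] and [B] determine the inner product of [X - A] with [B -
    A], hence the square of the determinant: the two solutions are mirror
    images in the line AB. *)
Lemma circles_det A B W X :
  nsq (X - A)%C = nsq (W - A)%C -> nsq (X - B)%C = nsq (W - B)%C ->
  det (B - A)%C (X - A)%C * det (B - A)%C (X - A)%C = det (B - A)%C (W - A)%C * det (B - A)%C (W - A)%C.
Proof.
destruct A as [a1 a2], B as [b1 b2], W as [w1 w2], X as [x1 x2]; unfold nsq, det; simpl.
set (u1 := b1 + - a1). set (u2 := b2 + - a2).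
set (v1 := x1 + - a1). set (v2 := x2 + - a2).
set (r1 := w1 + - a1). set (r2 := w2 + - a2).
replace (x1 + - b1) with (v1 - u1) by (unfold v1, u1; ring).
replace (x2 + - b2) with (v2 - u2) by (unfold v2, u2; ring).
replace (w1 + - b1) with (r1 - u1) by (unfold r1, u1; ring).
replace (w2 + - b2) with (r2 - u2) by (unfold r2, u2; ring).
intros H1 H2.
assert (H3 : u1 * v1 + u2 * v2 = u1 * r1 + u2 * r2) by lra.
replace ((u1 * v2 - u2 * v1) * (u1 * v2 - u2 * v1)) with
  ((u1*u1+u2*u2)*(v1*v1+v2*v2) - (u1 * v1 + u2 * v2)*(u1 * v1 + u2 * v2)) by ring.
rewrite H1, H3. ring.
Qed.

Lemma circles_unique A B W X : A <> B ->
  nsq (X - A)%C = nsq (W - A)%C -> nsq (X - B)%C = nsq (W - B)%C ->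
  det (B - A)%C (X - A)%C = det (B - A)%C (W - A)%C -> X = W.
Proof.
intros HAB H1 H2 H3.
assert (Hn : nsq (B - A)%C <> 0).
{ intros E; apply HAB; symmetry; now apply nsq_eq_0. }
apply nsq_eq_0. apply Rmult_eq_reg_l with (2 := Hn). rewrite Rmult_0_r.
revert H1 H2 H3.
destruct A as [a1 a2], B as [b1 b2], W as [w1 w2], X as [x1 x2]; unfold nsq, det; simpl.
set (u1 := b1 + - a1). set (u2 := b2 + - a2).
set (v1 := x1 + - a1). set (v2 := x2 + - a2).
set (r1 := w1 + - a1). set (r2 := w2 + - a2).
replace (x1 + - b1) with (v1 - u1) by (unfold v1, u1; ring).
replace (x2 + - b2) with (v2 - u2) by (unfold v2, u2; ring).
replace (w1 + - b1) with (r1 - u1) by (unfold r1, u1; ring).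
replace (w2 + - b2) with (r2 - u2) by (unfold r2, u2; ring).
replace (x1 + - w1) with (v1 - r1) by (unfold v1, r1; ring).
replace (x2 + - w2) with (v2 - r2) by (unfold v2, r2; ring).
intros H1 H2 H3.
assert (H4 : u1 * (v1 - r1) + u2 * (v2 - r2) = 0) by lra.
assert (H5 : u1 * (v2 - r2) - u2 * (v1 - r1) = 0) by lra.
replace ((u1 * u1 + u2 * u2) * ((v1 - r1) * (v1 - r1) + (v2 - r2) * (v2 - r2))) with
 ((u1 * (v1 - r1) + u2 * (v2 - r2)) * (u1 * (v1 - r1) + u2 * (v2 - r2)) +
  (u1 * (v2 - r2) - u2 * (v1 - r1)) * (u1 * (v2 - r2) - u2 * (v1 - r1))) by ring.
rewrite H4, H5. ring.
Qed.

(** On the line of centres the two circles are tangent, and meet in a single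
    point. *)
Lemma collinear_unique A B W X : A <> B -> det (B - A)%C (W - A)%C = 0 ->
  nsq (X - A)%C = nsq (W - A)%C -> nsq (X - B)%C = nsq (W - B)%C -> X = W.
Proof.
intros HAB H0 H1 H2. apply (circles_unique A B); auto.
pose proof (circles_det A B W X H1 H2) as E. rewrite H0 in *. nra.
Qed.

(** Here [A] and [B] are allowed to coincide, as happens when a coefficient of
    the series is 0. *)
Lemma midpoint_unique A B X :
  nsq (X - A)%C = nsq (B - A)%C / 4 -> nsq (X - B)%C = nsq (B - A)%C / 4 ->
  X = ((A + B) / 2)%C.
Proof.
destruct A as [a1 a2], B as [b1 b2], X as [x1 x2]; unfold nsq; simpl; intros H1 H2.
assert (E : (2*x1 - a1 - b1) * (2*x1 - a1 - b1) + (2*x2 - a2 - b2) * (2*x2 - a2 - b2) = 0) by lra.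
apply sum_sq_0 in E as [].
unfold Cdiv, Cmult, Cinv, Cplus; simpl. f_equal; lra.
Qed.

(** The bracing argument. [F] is forced to be the midpoint of AD; if v = A - P
    and w = D - Q, then F - E = (v + w) / 2, and v, w and their mean all have
    the same length. By the parallelogram law v = w, whatever the angle
    between AP and PQ, flat positions included. *)
Lemma parallelogram_unique P Q E A F D :
  E = ((P + Q) / 2)%C ->
  nsq (F - A)%C = nsq (Q - P)%C / 4 -> nsq (D - F)%C = nsq (Q - P)%C / 4 ->
  nsq (D - A)%C = nsq (Q - P)%C ->
  nsq (F - E)%C = nsq (A - P)%C -> nsq (D - Q)%C = nsq (A - P)%C ->
  D = (A + (Q - P))%C /\ F = (A + (Q - P) / 2)%C.
Proof.
intros -> H1 H2 H3 H4 H5.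
assert (HF : F = ((A + D) / 2)%C).
{ apply midpoint_unique. now rewrite H3. rewrite H3, <- H2.
  destruct F, D; unfold nsq; simpl; ring. }
subst F.
assert (HD : D = (A + (Q - P))%C).
{ clear H1 H2 H3.
  destruct A as [a1 a2], P as [p1 p2], Q as [q1 q2], D as [d1 d2].
  unfold nsq, Cdiv, Cmult, Cinv, Cplus, Cminus, Copp in *; simpl in *.
  assert (E : ((d1 - q1) - (a1 - p1)) * ((d1 - q1) - (a1 - p1)) +
          ((d2 - q2) - (a2 - p2)) * ((d2 - q2) - (a2 - p2)) = 0) by lra.
  apply sum_sq_0 in E as [].
  f_equal; lra. }
split; auto. rewrite HD. field.
Qed.

Lemma continuous_on_pair (g : R -> point) D : 
  continuous_on D g <-> continuous_on D (fun t => fst (g t)) /\ continuous_on D (fun t => snd (g t)).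
Proof.
split.
- intros H; split; intros t Ht P [e He]; specialize (H t Ht (ball (g t) e) (locally_ball _ _));
  destruct H as [d Hd]; exists d; intros y Hy Dy; apply He; apply (Hd y Hy Dy).
- intros [H1 H2] t Ht P [e He].
  destruct (H1 t Ht _ (locally_ball (fst (g t)) e)) as [d1 Hd1].
  destruct (H2 t Ht _ (locally_ball (snd (g t)) e)) as [d2 Hd2].
  exists (mkposreal _ (Rmin_stable_in_posreal d1 d2)).
  intros y Hy Dy. apply He. split.
  + apply Hd1; auto. apply Rlt_le_trans with (1 := Hy). apply Rmin_l.
  + apply Hd2; auto. apply Rlt_le_trans with (1 := Hy). apply Rmin_r.
Qed.

(** The two mirror solutions are separated by the sign of the determinant,
    which cannot change along a continuous motion in which the triangle never
    degenerates. *)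
Lemma dyad_unique (A B W X : R -> point) :
  continuous_on (interval 0 1) A -> continuous_on (interval 0 1) B ->
  continuous_on (interval 0 1) W -> continuous_on (interval 0 1) X ->
  X 0 = W 0 ->
  (forall t, interval 0 1 t -> nsq (X t - A t)%C = nsq (W t - A t)%C) ->
  (forall t, interval 0 1 t -> nsq (X t - B t)%C = nsq (W t - B t)%C) ->
  (forall t, interval 0 1 t -> det (B t - A t)%C (W t - A t)%C <> 0) ->
  forall t, interval 0 1 t -> X t = W t.
Proof.
intros HA HB HW HX H0 H1 H2 Hd t Ht.
set (dX := fun t => det (B t - A t)%C (X t - A t)%C).
set (dW := fun t => det (B t - A t)%C (W t - A t)%C).
assert (Hsq : forall t, interval 0 1 t -> dX t * dX t = dW t * dW t).
{ intros s Hs. apply circles_det; auto. }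
set (k := clamp 0 1).
assert (Hk : forall s, interval 0 1 (k s)) by (intros; apply clamp_in; lra).
assert (Hcl : forall Z : R -> point, continuous_on (interval 0 1) Z ->
   (forall s, continuous (fun s => fst (Z (k s))) s) /\ (forall s, continuous (fun s => snd (Z (k s))) s)).
{ intros Z HZ. apply continuous_on_pair in HZ as [HZ1 HZ2]. split.
  apply (continuous_clamp_ext (fun t => fst (Z t))); auto; lra.
  apply (continuous_clamp_ext (fun t => snd (Z t))); auto; lra. }
assert (Hdet : forall Z : R -> point, continuous_on (interval 0 1) Z ->
   forall s, continuous (fun s => det (B (k s) - A (k s))%C (Z (k s) - A (k s))%C) s).
{ intros Z HZ s. apply Hcl in HZ as [Z1 Z2].
  destruct (Hcl A HA) as [A1 A2]. destruct (Hcl B HB) as [B1 B2].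
  unfold det; simpl.
  apply (continuous_minus (V:=R_NormedModule)
   (fun s => (fst (B (k s)) + - fst (A (k s))) * (snd (Z (k s)) + - snd (A (k s))))
   (fun s => (snd (B (k s)) + - snd (A (k s))) * (fst (Z (k s)) + - fst (A (k s)))));
  apply continuous_mult_R; intros;
  match goal with |- continuous (fun s => ?f + - ?g) _ =>
    apply (continuous_minus (V:=R_NormedModule) (fun s => f) (fun s => g)) end; auto. }
assert (Hpos : forall s, interval 0 1 s -> 0 < dX s * dW s).
(* The product of the two orientations vanishes nowhere and is positive at
    time 0. *)
{ set (h := fun s => dX (k s) * dW (k s)).
  assert (hc : continuity h).
  { intros s. apply continuity_pt_filterlim. apply continuous_mult_R; intros; now apply Hdet. }
  assert (hn : forall s, h s <> 0).
  { intros s E. unfold h in E. specialize (Hsq _ (Hk s)). specialize (Hd _ (Hk s)).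
    fold (dW (k s)) in Hd. apply Rmult_integral in E as [E|E]; [|auto].
    rewrite E, Rmult_0_r in Hsq. apply Hd. symmetry in Hsq. now apply Rmult_integral in Hsq as []. }
  assert (h0 : 0 < h 0).
  { unfold h. assert (K0 : k 0 = 0) by (apply clamp_id; unfold interval; lra).
    rewrite K0. replace (dX 0) with (dW 0) by (unfold dX, dW; now rewrite H0).
    apply (Rsqr_pos_lt (dW 0)). apply Hd; unfold interval; lra. }
  intros s Hs. replace s with (k s) by now apply clamp_id. fold (h s).
  destruct (Rlt_le_dec 0 (h s)) as [|Hle]; auto. exfalso.
  destruct (IVT_gen h 0 s 0 hc) as [x [_ Hx]].
  rewrite Rmin_right, Rmax_left; lra. now apply (hn x). }
apply (circles_unique (A t) (B t)); auto.
- intros E. apply (Hd t Ht). rewrite E. unfold det; simpl; ring.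
- fold (dX t) (dW t). specialize (Hsq t Ht). specialize (Hpos t Ht).
  assert (E : (dX t - dW t) * (dX t + dW t) = 0) by lra.
  apply Rmult_integral in E as [E|E]; [lra|].
  replace (dX t) with (- dW t) in Hpos by lra. nra.
Qed.

Definition tends (x : nat -> C) (l : C) : Prop :=
  filterlim x eventually (locally (T := prod_UniformSpace R_UniformSpace R_UniformSpace) l).

Lemma tends_pair x l :
  tends x l <-> is_lim_seq (fun n => fst (x n)) (fst l) /\ is_lim_seq (fun n => snd (x n)) (snd l).
Proof.
split.
- intros H; split; intros P [e He]; destruct (H (ball (M := prod_UniformSpace R_UniformSpace R_UniformSpace) l e) (locally_ball _ _)) as [N HN];
  exists N; intros n Hn; apply He; apply (HN n Hn).
- intros [H1 H2] P [e He].
  destruct (H1 (ball (fst l) e) (locally_ball (fst l) e)) as [N1 HN1].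
  destruct (H2 (ball (snd l) e) (locally_ball (snd l) e)) as [N2 HN2].
  exists (N1 + N2)%nat; intros n Hn; apply He; split.
  apply HN1; lia. apply HN2; lia.
Qed.

Lemma tends_ext x y l : (forall n, x n = y n) -> tends x l -> tends y l.
Proof. intros H; now apply filterlim_ext. Qed.

Lemma tends_plus x y l m : tends x l -> tends y m -> tends (fun n => x n + y n)%C (l + m)%C.
Proof.
rewrite !tends_pair; intros [H1 H2] [H3 H4]; split; apply is_lim_seq_plus'; auto.
Qed.

Lemma tends_scal (a : C) x : tends x 0%C -> tends (fun n => a * x n)%C 0%C.
Proof.
rewrite !tends_pair; intros [H1 H2]; split; simpl.
- replace (Finite 0) with (Finite (fst a * 0 - snd a * 0)) by (f_equal; ring).
  apply is_lim_seq_minus'; apply is_lim_seq_mult'; auto; apply is_lim_seq_const.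
- replace (Finite 0) with (Finite (fst a * 0 + snd a * 0)) by (f_equal; ring).
  apply is_lim_seq_plus'; apply is_lim_seq_mult'; auto; apply is_lim_seq_const.
Qed.

Lemma tends_incr x l : tends (fun n => x (S n)) l <-> tends x l.
Proof. rewrite !tends_pair, <- !(is_lim_seq_incr_1 (fun n => _ (x n))). tauto. Qed.

Lemma tends_0 x : is_lim_seq (fun n => nsq (x n)) 0 <-> tends x 0%C.
Proof.
split.
- intros H. assert (L : forall f : C -> R, (forall v : C, f v * f v <= nsq v) -> is_lim_seq (fun n => f (x n)) 0).
  { intros f Hf. apply (is_lim_seq_abs_0 (fun n => f (x n))).
    apply is_lim_seq_le_le with (fun _ => 0) (fun n => sqrt (nsq (x n))).
    - intros n; split; [apply Rabs_pos|]. rewrite <- sqrt_Rsqr_abs. apply sqrt_le_1_alt. apply Hf.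
    - apply is_lim_seq_const.
    - rewrite <- sqrt_0. apply is_lim_seq_continuous; auto. apply continuity_pt_sqrt; lra. }
  apply tends_pair; split; [apply (L fst)|apply (L snd)]; intros; unfold nsq; nra.
- rewrite tends_pair; simpl; intros [H1 H2]. unfold nsq.
  replace (Finite 0) with (Finite (0 * 0 + 0 * 0)) by (f_equal; ring).
  apply is_lim_seq_plus'; apply is_lim_seq_mult'; auto.
Qed.

(** * The infinite rotor linkage: positions and edges *)

Definition cis (x : R) : C := (cos x, sin x).

(** The rotation by the angle [s * x] when [s] is 1 or -1. *)
Definition turn (s x : R) : C := (cos x, s * sin x).

Lemma nsq_cis x : nsq (cis x) = 1.
Proof. unfold nsq, cis; simpl. pose proof (sin2_cos2 x); unfold Rsqr in *; lra. Qed.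

Lemma cis_plus x y : cis (x + y) = (cis x * cis y)%C.
Proof. unfold cis, Cmult; simpl. rewrite cos_plus, sin_plus. f_equal; ring. Qed.

Lemma nsq_RtoC r : nsq (RtoC r) = r * r.
Proof. unfold nsq; simpl; ring. Qed.

Lemma det_mult z v w : det (z * v)%C (z * w)%C = nsq z * det v w.
Proof. destruct z, v, w; unfold det, nsq; simpl; ring. Qed.

(** Even steps prolong the chain of increasing powers of [z], odd steps the
    chain of decreasing powers. *)
Fixpoint chain_sign (n : nat) : R := match n with O => 1 | S O => -1 | S (S m) => chain_sign m end.
(** The frequencies 1, 0, 2, -1, 3, -2, and so on: every integer occurs
    exactly once. *)
Fixpoint frequency (n : nat) : R := match n with O => 1 | S O => 0 | S (S m) => frequency m + chain_sign m end.
(** Bar lengths halve each time that a chain is prolonged. *)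
Fixpoint bar (n : nat) : R := match n with O => 1 | S O => 1 | S (S m) => bar m / 2 end.

Lemma nat_two_step_ind (P : nat -> Prop) : P 0%nat -> P 1%nat -> (forall n, P n -> P (S (S n))) -> forall n, P n.
Proof.
intros H0 H1 H n. enough (P n /\ P (S n)) by tauto.
induction n as [|n [IH1 IH2]]; auto.
Qed.

Lemma chain_sign_sqr n : chain_sign n * chain_sign n = 1.
Proof. induction n using nat_two_step_ind; simpl; lra. Qed.

Lemma bar_pos n : 0 < bar n.
Proof. induction n using nat_two_step_ind; simpl; lra. Qed.

Lemma bar_lim : is_lim_seq bar 0.
Proof.
assert (H : forall n, bar n <= 2 * (3/4) ^ n).
{ induction n using nat_two_step_ind; simpl; [lra|lra|].
  assert (0 < (3/4)^n) by (apply pow_lt; lra). lra. }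
apply is_lim_seq_le_le with (fun _ => 0) (fun n => 2 * (3/4)^n).
- intros n. split; auto. pose proof (bar_pos n); lra.
- apply is_lim_seq_const.
- replace (Finite 0) with (Finite (2 * 0)) by (f_equal; ring).
  apply is_lim_seq_mult'. apply is_lim_seq_const. apply is_lim_seq_geom. rewrite Rabs_pos_eq; lra.
Qed.

(** The direction along which step [n] moves. [dirA n] is the direction
    preceding it in the same chain, and both chains serve in turn, so that
    [dirA (S (S n))] is [dirB n]. *)
Definition dirB (n : nat) (x : R) : C := cis (frequency n * x).
Definition dirA (n : nat) (x : R) : C := cis ((frequency n - chain_sign n) * x).

Lemma dirA_SS n x : dirA (S (S n)) x = dirB n x.
Proof. unfold dirA, dirB; simpl. f_equal; ring. Qed.

Lemma cis_chain_sign n x : cis (chain_sign n * x) = turn (chain_sign n) x.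
Proof.
induction n using nat_two_step_ind; simpl; auto; unfold cis, turn.
- rewrite Rmult_1_l. f_equal; ring.
- replace (-1 * x) with (- x) by ring. rewrite cos_neg, sin_neg. f_equal; ring.
Qed.

Lemma dirB_SS n x : dirB (S (S n)) x = (dirB n x * turn (chain_sign n) x)%C.
Proof.
unfold dirB. simpl. rewrite <- cis_chain_sign, <- cis_plus. f_equal; ring.
Qed.

Lemma dirA_dirB n x : dirA n x = (dirB n x * turn (- chain_sign n) x)%C.
Proof.
unfold dirA, dirB.
replace ((frequency n - chain_sign n) * x) with (frequency n * x + (- (chain_sign n * x))) by ring.
rewrite cis_plus. f_equal. 
pose proof (cis_chain_sign n x) as E. unfold cis, turn in *. injection E as E1 E2.
rewrite cos_neg, sin_neg, E1, E2. f_equal. ring.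
Qed.

Fixpoint tip (c : nat -> C) (x : R) (n : nat) : C :=
  match n with O => 0%C | S m => (tip c x m + c m * dirB m x)%C end.

(** In the frame where the bars are A = turn (- s) x and B = 1/2, the fourth
    vertex of the antiparallelogram on 0, A, B: the mirror image of 0 in the
    perpendicular bisector of AB. *)
Definition reflY (s x : R) : C :=
  (- 3 / (5 - 4 * cos x) * (/ 2 - cos x), - 3 / (5 - 4 * cos x) * (s * sin x)).
(** The fourth vertex of the second antiparallelogram, half the size of the
    first and sharing the side from 0 to B: it lies on the line from B to
    [reflY], at a quarter of the distance. *)
Definition reflY' (s x : R) : C :=
  (3 / 4 / (5 - 4 * cos x) * (2 - cos x), - (3 / 4 / (5 - 4 * cos x) * (s * sin x))).

(** The position of vertex [k] of block [n] when the input angle is [x]. In a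
    block [S m] with base point P, vertices 0, 1, 2 are the two
    antiparallelogram vertices and the tip of the new bar, 3 is the next
    partial sum P', 4 the midpoint of PP', and each pair (5,6), (7,8), (9,10),
    (11,12) transports one bar from P to P': first the midpoint of the brace,
    then the transported tip. The state handed on is P' = 3, the pair 6, 8
    along which the next step moves, and the pair 10, 12 for the step after.
    Block 0 consists of the origin 0, the base vertex 1, the driving vertex 2,
    a second vertex 3 at the origin, which relieves vertex 0 so that it keeps
    degree two, and the initial state in the same places, padded with vertices
    at the position of vertex 1. *)
Definition slot (c : nat -> C) (x : R) (n k : nat) : C :=
  match n with
  | O => match k with
         | 0 | 3 => 0
         | 2 | 10 => cis x
         | 8 => cis x * RtoC (/ 2)
         | 12 => RtoC (/ 2)
         | _ => 1
         end
  | S m =>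
    let P := tip c x m in
    let z := (dirB m x * RtoC (bar m))%C in
    let d := (c m * dirB m x)%C in
    let h := (d * RtoC (/ 2))%C in
    let XA := (dirA (S m) x * RtoC (bar (S m)))%C in
    let XB := (dirB (S m) x * RtoC (bar (S m) / 2))%C in
    let XC := (z * RtoC (/ 2))%C in
    let XD := (z * (turn (chain_sign m) x * RtoC (/ 4)))%C in
    match k with
    | 0 => P + z * reflY (chain_sign m) x
    | 1 => P + z * reflY' (chain_sign m) x
    | 2 => P + XD
    | 3 => P + d
    | 4 => P + h
    | 5 => P + XA + h
    | 6 => P + XA + d
    | 7 => P + XB + h
    | 8 => P + XB + d
    | 9 => P + XC + h
    | 10 => P + XC + d
    | 11 => P + XD + h
    | _ => P + XD + d
    end
  end%C.

Lemma slot_tip c x n : slot c x n 3 = tip c x n.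
Proof. destruct n; reflexivity. Qed.

Ltac by_coordinates := apply injective_projections; cbn -[tip dirA dirB bar chain_sign reflY reflY']; try ring.

Lemma slot_A c x n : slot c x n 6 = (tip c x n + dirA n x * RtoC (bar n))%C.
Proof.
destruct n as [|n].
- unfold dirA; simpl. rewrite Rminus_diag, Rmult_0_l. unfold cis. rewrite cos_0, sin_0. by_coordinates.
- simpl tip. unfold slot. ring.
Qed.

Lemma slot_B c x n : slot c x n 8 = (tip c x n + dirB n x * RtoC (bar n / 2))%C.
Proof.
destruct n as [|n].
- unfold dirB; simpl. rewrite Rmult_1_l. by_coordinates; field.
- simpl tip. unfold slot. ring.
Qed.

Lemma slot_A' c x n : slot c x n 10 = (tip c x n + dirA (S n) x * RtoC (bar (S n)))%C.
Proof.
destruct n as [|n].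
- unfold dirA; simpl. replace ((0 - -1) * x) with x by ring. by_coordinates.
- simpl tip. rewrite dirA_SS. unfold slot. simpl (bar (S (S n))). by_coordinates; field.
Qed.

Lemma slot_B' c x n : slot c x n 12 = (tip c x n + dirB (S n) x * RtoC (bar (S n) / 2))%C.
Proof.
destruct n as [|n].
- unfold dirB; simpl. rewrite Rmult_0_l. unfold cis; rewrite cos_0, sin_0. by_coordinates; field.
- simpl tip. rewrite dirB_SS. unfold slot. simpl (bar (S (S n))). by_coordinates; field.
Qed.

Lemma slot_A_rel c x n :
  slot c x n 6 = (tip c x n + dirB n x * RtoC (bar n) * turn (- chain_sign n) x)%C.
Proof. rewrite slot_A, dirA_dirB. ring. Qed.

Lemma slot_B_rel c x n :
  slot c x n 8 = (tip c x n + dirB n x * RtoC (bar n) * RtoC (/ 2))%C.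
Proof. rewrite slot_B. by_coordinates; field. Qed.

(** The edges, each listed at its later end. Two parents make a dyad or a
    collinear point; the vertices with three parents are the transported tips,
    whose edges brace the parallelogram together with those of the vertex
    before. *)
Definition parents (n k : nat) : list (nat * nat) :=
  match n with
  | O => match k with
         | 0 => []
         | 1 | 2 => [(0, 0)]
         | 3 => [(0, 1); (0, 2)]
         | 8 | 10 => [(0, 2); (0, 3)]
         | _ => [(0, 1); (0, 3)]
         end
  | S m => match k with
           | 0 => [(m, 6); (m, 8)]
           | 1 => [(m, 8); (n, 0)]
           | 2 => [(m, 3); (n, 1)]
           | 3 => [(m, 3); (m, 8)]
           | 4 => [(m, 3); (n, 3)]
           | 5 => [(m, 10); (n, 4)]
           | 6 => [(m, 10); (n, 3); (n, 5)]
           | 7 => [(m, 12); (n, 4)]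
           | 8 => [(m, 12); (n, 3); (n, 7)]
           | 9 => [(m, 8); (n, 4)]
           | 10 => [(m, 8); (n, 3); (n, 9)]
           | 11 => [(n, 2); (n, 4)]
           | _ => [(n, 2); (n, 3); (n, 11)]
           end
  end%nat%list.

Lemma cos_den x : 0 < 5 - 4 * cos x.
Proof. pose proof (COS_bound x). lra. Qed.

Lemma sin_sqr x : sin x * sin x = 1 - cos x * cos x.
Proof. pose proof (sin2_cos2 x); unfold Rsqr in *; lra. Qed.

Lemma nsq_frame P z v w : nsq ((P + z * v) - (P + z * w))%C = nsq z * nsq (v - w)%C.
Proof. rewrite <- nsq_mult. f_equal. ring. Qed.

Lemma nsq_arm n x : nsq (dirB n x * RtoC (bar n))%C = bar n * bar n.
Proof. unfold dirB. rewrite nsq_mult, nsq_cis, nsq_RtoC. ring. Qed.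

Ltac reflector_coordinates s x :=
  intros Hs; pose proof (cos_den x) as Hd; pose proof (sin_sqr x) as Hx;
  unfold nsq, reflY, reflY', turn; simpl;
  assert (Hsx : (s * sin x) * (s * sin x) = 1 - cos x * cos x)
   by (replace ((s * sin x) * (s * sin x)) with ((s * s) * (sin x * sin x)) by ring; rewrite Hs, Hx; ring);
  replace (- s * sin x) with (- (s * sin x)) by ring;
  set (c := cos x) in *; set (y := s * sin x) in *.

Lemma reflY_A_length s x : s * s = 1 -> nsq (reflY s x - turn (- s) x)%C = / 4.
Proof.
reflector_coordinates s x.
transitivity (((- 3 * (/2 - c) - c * (5 - 4 * c)) * (- 3 * (/2 - c) - c * (5 - 4 * c)) +
  (2 - 4 * c) * (2 - 4 * c) * (y * y)) / ((5 - 4 * c) * (5 - 4 * c))).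
{ field; lra. }
rewrite Hsx. field; lra.
Qed.

Lemma reflY_B_length s x : s * s = 1 -> nsq (reflY s x - RtoC (/ 2))%C = 1.
Proof.
reflector_coordinates s x.
transitivity (((- 3 * (/2 - c) - (5 - 4 * c) / 2) * (- 3 * (/2 - c) - (5 - 4 * c) / 2) +
  9 * (y * y)) / ((5 - 4 * c) * (5 - 4 * c))).
{ field; lra. }
rewrite Hsx. field; lra.
Qed.

(** Similarity of the two antiparallelograms: the side from B to the second
    vertex is a quarter of the side from B to the first. *)
Lemma reflY'_reflY s x : (reflY' s x - RtoC (/ 2) = (reflY s x - RtoC (/ 2)) * RtoC (/ 4))%C.
Proof.
pose proof (cos_den x). unfold reflY, reflY'. by_coordinates; field; lra.
Qed.

Lemma reflY'_B_length s x : s * s = 1 -> nsq (reflY' s x - RtoC (/ 2))%C = / 16.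
Proof. intros Hs. rewrite reflY'_reflY, nsq_mult, reflY_B_length, nsq_RtoC; auto. field. Qed.

Lemma reflY'_reflY_length s x : s * s = 1 -> nsq (reflY' s x - reflY s x)%C = 9 / 16.
Proof.
intros Hs.
replace (reflY' s x - reflY s x)%C with ((reflY s x - RtoC (/ 2)) * RtoC (- 3 / 4))%C.
- rewrite nsq_mult, reflY_B_length, nsq_RtoC; auto. field.
- replace (reflY' s x) with (RtoC (/ 2) + (reflY s x - RtoC (/ 2)) * RtoC (/ 4))%C.
  by_coordinates; field. rewrite <- reflY'_reflY. ring.
Qed.

Lemma turn_reflY'_length s x : s * s = 1 -> nsq (turn s x * RtoC (/ 4) - reflY' s x)%C = / 4.
Proof.
reflector_coordinates s x.
transitivity (((c * (5 - 4 * c) / 4 - 3 / 4 * (2 - c)) * (c * (5 - 4 * c) / 4 - 3 / 4 * (2 - c)) +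
  (2 - c) * (2 - c) * (y * y)) / ((5 - 4 * c) * (5 - 4 * c))).
{ field; lra. }
rewrite Hsx. field; lra.
Qed.

Lemma nsq_turn s x : s * s = 1 -> nsq (turn s x) = 1.
Proof. reflector_coordinates s x. lra. Qed.

(** Both determinants below are nonzero multiples of the sine of the input
    angle: within (0, pi) the antiparallelograms stay open, however often the
    direction of the whole frame has turned. *)
Lemma det_reflY s x : det (RtoC (/ 2) - turn (- s) x)%C (reflY s x - turn (- s) x)%C = s * sin x / 2.
Proof. pose proof (cos_den x). unfold det, reflY, turn; simpl. field; lra. Qed.

Lemma det_reflY'_turn s x : det (reflY' s x) (turn s x * RtoC (/ 4))%C = 3 / 8 * (s * sin x) / (5 - 4 * cos x).
Proof. pose proof (cos_den x). unfold det, reflY', turn; simpl. field; lra. Qed.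

(** * Edge lengths are independent of the angle *)

Lemma nsq_dirA n x : nsq (dirA n x) = 1.
Proof. apply nsq_cis. Qed.

Lemma nsq_dirB n x : nsq (dirB n x) = 1.
Proof. apply nsq_cis. Qed.

Ltac length_as v := match goal with |- nsq ?d = _ => replace d with v by (by_coordinates; field) end;
  rewrite ?nsq_mult, ?nsq_RtoC, ?nsq_dirA, ?nsq_dirB, ?(nsq_turn _ _ (chain_sign_sqr _)), ?nsq_cis.
Ltac list_cases H := simpl in H; repeat (destruct H as [<-|H]); try contradiction; cbv [fst snd].

Definition rigid_edge (S : R -> nat -> nat -> C) (n k : nat) (p : nat * nat) : Prop :=
  exists L, forall x, nsq (S x n k - S x (fst p) (snd p))%C = L.

Lemma edge_rigid_0 c k p : (k < 13)%nat -> In p (parents 0 k) -> rigid_edge (slot c) 0 k p.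
Proof.
intros Hk Hp. unfold rigid_edge.
do 13 (try (destruct k as [|k]; [list_cases Hp|])); try lia.
all: unfold slot.
all: match goal with
  | |- exists L, forall x, nsq (cis x * _ - cis x)%C = L => exists (/ 4); intros x; length_as (cis x * RtoC (- / 2))%C; field
  | |- exists L, forall x, nsq (cis x * _ - _)%C = L => exists (/ 4); intros x; length_as (cis x * RtoC (/ 2))%C; field
  | |- exists L, forall x, nsq (cis x - cis x)%C = L => exists 0; intros x; length_as (RtoC 0); ring
  | |- exists L, forall x, nsq (cis x - _)%C = L => exists 1; intros x; length_as (cis x); ring
  | |- exists L, forall x, nsq (_ - cis x)%C = L => exists 1; intros x; length_as (cis x * RtoC (- 1))%C; ring
  | |- exists L, forall x, nsq (?d)%C = L => exists (nsq d); reflexivity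
 end.
Qed.

(** In the rotating frame of the base point the reflector depends on [x] only
    through its shape, and its sides are constant; all other edges are bars
    multiplied by constants. *)
Lemma edge_rigid_S c m k p : (k < 13)%nat -> In p (parents (S m) k) -> rigid_edge (slot c) (S m) k p.
Proof.
intros Hk Hp. unfold rigid_edge.
do 13 (try (destruct k as [|k]; [list_cases Hp|])); try lia.
- exists (bar m * bar m * / 4). intros x. rewrite (slot_A_rel c x m). unfold slot.
  rewrite nsq_frame, nsq_arm, reflY_A_length; auto. apply chain_sign_sqr.
- exists (bar m * bar m * 1). intros x. rewrite (slot_B_rel c x m). unfold slot.
  rewrite nsq_frame, nsq_arm, reflY_B_length; auto. apply chain_sign_sqr.
- exists (bar m * bar m * / 16). intros x. rewrite (slot_B_rel c x m). unfold slot.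
  rewrite nsq_frame, nsq_arm, reflY'_B_length; auto. apply chain_sign_sqr.
- exists (bar m * bar m * (9 / 16)). intros x. unfold slot.
  rewrite nsq_frame, nsq_arm, reflY'_reflY_length; auto. apply chain_sign_sqr.
- exists (bar m * bar m * / 16). intros x. rewrite (slot_tip c x m). unfold slot.
  length_as (dirB m x * RtoC (bar m) * (turn (chain_sign m) x * RtoC (/ 4)))%C. field.
- exists (bar m * bar m * / 4). intros x. unfold slot.
  rewrite nsq_frame, nsq_arm, turn_reflY'_length; auto. apply chain_sign_sqr.
- exists (nsq (c m)). intros x. rewrite (slot_tip c x m). unfold slot.
  length_as (c m * dirB m x)%C. ring.
(* The triangle on the bar and the step keeps its shape: it only rotates. *)
- exists (nsq (c m - RtoC (bar m / 2))%C). intros x. rewrite (slot_B c x m). unfold slot.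
  length_as ((c m - RtoC (bar m / 2)) * dirB m x)%C. ring.
- exists (nsq (c m) / 4). intros x. rewrite (slot_tip c x m). unfold slot.
  length_as (c m * dirB m x * RtoC (/ 2))%C. field.
- exists (nsq (c m) / 4). intros x. unfold slot.
  length_as (c m * dirB m x * RtoC (- / 2))%C. field.
- exists (nsq (c m) / 4). intros x. rewrite (slot_A' c x m). unfold slot.
  length_as (c m * dirB m x * RtoC (/ 2))%C. field.
- exists (bar (S m) * bar (S m)). intros x. unfold slot.
  length_as (dirA (S m) x * RtoC (bar (S m)))%C. ring.
- exists (nsq (c m)). intros x. rewrite (slot_A' c x m). unfold slot.
  length_as (c m * dirB m x)%C. ring.
- exists (bar (S m) * bar (S m)). intros x. unfold slot.
  length_as (dirA (S m) x * RtoC (bar (S m)))%C. ring.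
- exists (nsq (c m) / 4). intros x. unfold slot.
  length_as (c m * dirB m x * RtoC (/ 2))%C. field.
- exists (nsq (c m) / 4). intros x. rewrite (slot_B' c x m). unfold slot.
  length_as (c m * dirB m x * RtoC (/ 2))%C. field.
- exists (bar (S m) / 2 * (bar (S m) / 2)). intros x. unfold slot.
  length_as (dirB (S m) x * RtoC (bar (S m) / 2))%C. ring.
- exists (nsq (c m)). intros x. rewrite (slot_B' c x m). unfold slot.
  length_as (c m * dirB m x)%C. ring.
- exists (bar (S m) / 2 * (bar (S m) / 2)). intros x. unfold slot.
  length_as (dirB (S m) x * RtoC (bar (S m) / 2))%C. ring.
- exists (nsq (c m) / 4). intros x. unfold slot.
  length_as (c m * dirB m x * RtoC (/ 2))%C. field.
- exists (nsq (c m) / 4). intros x. rewrite (slot_B c x m). unfold slot.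
  length_as (c m * dirB m x * RtoC (/ 2))%C. field.
- exists (bar m * bar m / 4). intros x. unfold slot.
  length_as (dirB m x * RtoC (bar m) * RtoC (/ 2))%C. field.
- exists (nsq (c m)). intros x. rewrite (slot_B c x m). unfold slot.
  length_as (c m * dirB m x)%C. ring.
- exists (bar m * bar m / 4). intros x. unfold slot.
  length_as (dirB m x * RtoC (bar m) * RtoC (/ 2))%C. field.
- exists (nsq (c m) / 4). intros x. unfold slot.
  length_as (c m * dirB m x * RtoC (/ 2))%C. field.
- exists (nsq (c m) / 4). intros x. unfold slot.
  length_as (c m * dirB m x * RtoC (/ 2))%C. field.
- exists (bar m * bar m / 16). intros x. unfold slot.
  length_as (dirB m x * RtoC (bar m) * (turn (chain_sign m) x * RtoC (/ 4)))%C. field.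
- exists (nsq (c m)). intros x. unfold slot.
  length_as (c m * dirB m x)%C. ring.
- exists (bar m * bar m / 16). intros x. unfold slot.
  length_as (dirB m x * RtoC (bar m) * (turn (chain_sign m) x * RtoC (/ 4)))%C. field.
- exists (nsq (c m) / 4). intros x. unfold slot.
  length_as (c m * dirB m x * RtoC (/ 2))%C. field.
Qed.

(** * The flex is determined by the first three vertices *)

Definition continuous_curve (g : R -> C) : Prop :=
  (forall x, continuous (fun x => fst (g x)) x) /\ (forall x, continuous (fun x => snd (g x)) x).

Lemma continuous_curve_const v : continuous_curve (fun _ => v).
Proof. split; intros; apply continuous_const. Qed.

Lemma continuous_curve_plus f g : continuous_curve f -> continuous_curve g -> continuous_curve (fun x => f x + g x)%C.
Proof. intros [F1 F2] [G1 G2]; split; simpl; apply continuous_plus_R; auto. Qed.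

Lemma continuous_curve_mult f g : continuous_curve f -> continuous_curve g -> continuous_curve (fun x => f x * g x)%C.
Proof.
intros [F1 F2] [G1 G2]; split; simpl; intros x.
- apply (continuous_minus (V:=R_NormedModule) (fun x => fst (f x) * fst (g x)) (fun x => snd (f x) * snd (g x)));
  apply continuous_mult_R; auto.
- apply (continuous_plus_R (fun x => fst (f x) * snd (g x)) (fun x => snd (f x) * fst (g x)));
  apply continuous_mult_R; auto.
Qed.

Lemma continuous_curve_derive (f g : R -> R) : (forall x, ex_derive f x) -> (forall x, ex_derive g x) ->
  continuous_curve (fun x => (f x, g x)).
Proof. intros Hf Hg; split; intros x; simpl; apply (ex_derive_continuous (V:=R_NormedModule)); auto. Qed.

Lemma continuous_curve_comp f phi : continuous_curve f -> (forall t, continuous phi t) -> continuous_curve (fun t => f (phi t)).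
Proof.
intros [F1 F2] Hp; split; intros t; simpl.
- apply (continuous_comp phi (fun x => fst (f x))); auto.
- apply (continuous_comp phi (fun x => snd (f x))); auto.
Qed.

Lemma continuous_curve_cis k : continuous_curve (fun x => cis (k * x)).
Proof. apply continuous_curve_derive; intros; auto_derive; auto. Qed.

Lemma continuous_curve_tip c n : continuous_curve (fun x => tip c x n).
Proof.
induction n; simpl; [apply continuous_curve_const|].
apply continuous_curve_plus; auto. apply continuous_curve_mult; [apply continuous_curve_const|apply continuous_curve_cis].
Qed.

Lemma continuous_curve_turn s : continuous_curve (turn s).
Proof. apply continuous_curve_derive; intros; auto_derive; auto. Qed.

Lemma continuous_curve_reflY s : continuous_curve (reflY s).
Proof. apply continuous_curve_derive; intros x; pose proof (cos_den x); auto_derive; lra. Qed.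

Lemma continuous_curve_reflY' s : continuous_curve (reflY' s).
Proof. apply continuous_curve_derive; intros x; pose proof (cos_den x); auto_derive; lra. Qed.

Lemma continuous_curve_cis1 : continuous_curve cis.
Proof. apply continuous_curve_derive; intros; auto_derive; auto. Qed.

Lemma continuous_curve_slot c n k : continuous_curve (fun x => slot c x n k).
Proof.
destruct n as [|m]; unfold slot;
do 13 (try (destruct k as [|k])); cbv zeta;
repeat match goal with
| |- continuous_curve (fun _ => ?v) => apply (continuous_curve_const v)
| |- continuous_curve (fun x => tip _ x _) => apply continuous_curve_tip
| |- continuous_curve cis => apply continuous_curve_cis1
| |- continuous_curve (fun x => cis x) => apply continuous_curve_cis1
| |- continuous_curve (turn _) => apply continuous_curve_turn
| |- continuous_curve (reflY _) => apply continuous_curve_reflY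
| |- continuous_curve (reflY' _) => apply continuous_curve_reflY'
| |- continuous_curve (dirB _) => apply continuous_curve_cis
| |- continuous_curve (dirA _) => apply continuous_curve_cis
| |- continuous_curve (fun x => (_ + _)%C) => apply continuous_curve_plus
| |- continuous_curve (fun x => (_ * _)%C) => apply continuous_curve_mult
end.
Qed.

Definition agree (c : nat -> C) (phi : R -> R) (q : nat -> nat -> R -> C) (n k : nat) : Prop :=
  forall t, interval 0 1 t -> q n k t = slot c (phi t) n k.

(** The properties of a competing flex [q] that force it to be the
    articulating one, in block coordinates. *)
Record same_lengths (c : nat -> C) (phi : R -> R) (q : nat -> nat -> R -> C) : Prop := {
  sl_phi : forall t, continuous phi t;
  sl_range : forall t, interval 0 1 t -> 0 < phi t < PI;
  sl_cont : forall n k, (k < 13)%nat -> continuous_on (interval 0 1) (q n k : R -> point);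
  sl_init : forall n k, (k < 13)%nat -> q n k 0 = slot c (phi 0) n k;
  sl_edge : forall n k n' k', (k < 13)%nat -> In (n', k') (parents n k) -> forall t, interval 0 1 t ->
    nsq (q n k t - q n' k' t)%C = nsq (slot c (phi t) n k - slot c (phi t) n' k')%C }.

Lemma slot_continuous_on c phi n k : (forall t, continuous phi t) ->
  continuous_on (interval 0 1) (fun t => slot c (phi t) n k : point).
Proof.
intros Hp. apply continuous_on_pair.
destruct (continuous_curve_comp _ phi (continuous_curve_slot c n k) Hp) as [H1 H2].
split; apply continuous_everywhere_on; auto.
Qed.

Lemma agree_dyad c phi q n k n1 k1 n2 k2 : same_lengths c phi q ->
  (k < 13)%nat -> (k1 < 13)%nat -> (k2 < 13)%nat ->
  In (n1, k1) (parents n k) -> In (n2, k2) (parents n k) ->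
  agree c phi q n1 k1 -> agree c phi q n2 k2 ->
  (forall t, interval 0 1 t ->
    det (slot c (phi t) n2 k2 - slot c (phi t) n1 k1)%C (slot c (phi t) n k - slot c (phi t) n1 k1)%C <> 0) ->
  agree c phi q n k.
Proof.
intros SL Hk Hk1 Hk2 I1 I2 A1 A2 Hd.
pose proof (fun n k => slot_continuous_on c phi n k (sl_phi _ _ _ SL)) as Hc.
unfold agree.
apply (dyad_unique (fun t => slot c (phi t) n1 k1) (fun t => slot c (phi t) n2 k2)
   (fun t => slot c (phi t) n k) (q n k)); auto.
- apply (sl_cont _ _ _ SL n k Hk).
- apply (sl_init _ _ _ SL n k Hk).
- intros t Ht. rewrite <- (sl_edge _ _ _ SL n k n1 k1 Hk I1 t Ht), (A1 t Ht). reflexivity.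
- intros t Ht. rewrite <- (sl_edge _ _ _ SL n k n2 k2 Hk I2 t Ht), (A2 t Ht). reflexivity.
Qed.

Lemma agree_collinear c phi q n k n1 k1 n2 k2 : same_lengths c phi q ->
  (k < 13)%nat ->
  In (n1, k1) (parents n k) -> In (n2, k2) (parents n k) ->
  agree c phi q n1 k1 -> agree c phi q n2 k2 ->
  (forall t, interval 0 1 t -> slot c (phi t) n1 k1 <> slot c (phi t) n2 k2) ->
  (forall t, interval 0 1 t ->
    det (slot c (phi t) n2 k2 - slot c (phi t) n1 k1)%C (slot c (phi t) n k - slot c (phi t) n1 k1)%C = 0) ->
  agree c phi q n k.
Proof.
intros SL Hk I1 I2 A1 A2 Hn Hd t Ht.
apply (collinear_unique (slot c (phi t) n1 k1) (slot c (phi t) n2 k2)); auto.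
- rewrite <- (sl_edge _ _ _ SL n k n1 k1 Hk I1 t Ht), (A1 t Ht). reflexivity.
- rewrite <- (sl_edge _ _ _ SL n k n2 k2 Hk I2 t Ht), (A2 t Ht). reflexivity.
Qed.

Lemma agree_transport c phi q m k nA kA : same_lengths c phi q ->
  (S k < 13)%nat ->
  In (nA, kA) (parents (S m) k) -> In (S m, 4%nat) (parents (S m) k) ->
  In (nA, kA) (parents (S m) (S k)) -> In (S m, 3%nat) (parents (S m) (S k)) ->
  In (S m, k) (parents (S m) (S k)) ->
  agree c phi q nA kA -> agree c phi q (S m) 3 -> agree c phi q (S m) 4 ->
  (forall x, slot c x (S m) k = slot c x nA kA + c m * dirB m x * RtoC (/ 2))%C ->
  (forall x, slot c x (S m) (S k) = slot c x nA kA + c m * dirB m x)%C ->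
  agree c phi q (S m) k /\ agree c phi q (S m) (S k).
Proof.
intros SL Hk I1 I2 I3 I4 I5 AA A3 A4 E1 E2.
assert (Hk' : (k < 13)%nat) by lia.
assert (main : forall t, interval 0 1 t ->
  q (S m) k t = slot c (phi t) (S m) k /\ q (S m) (S k) t = slot c (phi t) (S m) (S k)).
{ intros t Ht.
  pose proof (sl_edge _ _ _ SL _ _ _ _ Hk' I1 t Ht) as L1.
  pose proof (sl_edge _ _ _ SL _ _ _ _ Hk' I2 t Ht) as L2.
  pose proof (sl_edge _ _ _ SL _ _ _ _ Hk I3 t Ht) as L3.
  pose proof (sl_edge _ _ _ SL _ _ _ _ Hk I4 t Ht) as L4.
  pose proof (sl_edge _ _ _ SL _ _ _ _ Hk I5 t Ht) as L5.
  rewrite (AA t Ht) in L1, L3. rewrite (A4 t Ht) in L2. rewrite (A3 t Ht) in L4.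
  rewrite E1 in L1, L2, L5. rewrite E2 in L3, L4, L5. rewrite E1, E2.
  set (x := phi t) in *. set (A := slot c x nA kA) in *. set (d := (c m * dirB m x)%C) in *.
  set (F := q (S m) k t) in *. set (D := q (S m) (S k) t) in *.
  assert (EQ : slot c x (S m) 3 = (tip c x m + d)%C) by reflexivity.
  assert (EE : slot c x (S m) 4 = (tip c x m + d * RtoC (/ 2))%C) by reflexivity.
  rewrite EQ in L4. rewrite EE in L2.
  assert (N : forall v, nsq (v * RtoC (/ 2))%C = nsq v / 4).
  { intros; rewrite nsq_mult, nsq_RtoC; field. }
  destruct (parallelogram_unique (tip c x m) (tip c x m + d)%C (tip c x m + d * RtoC (/ 2))%C A F D) as [HD HF].
  - by_coordinates; field.
  - rewrite L1. replace (A + d * RtoC (/2) - A)%C with (d * RtoC (/ 2))%C by ring.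
    rewrite N. do 2 f_equal. ring.
  - rewrite L5. replace (A + d - (A + d * RtoC (/2)))%C with (d * RtoC (/ 2))%C by (by_coordinates; field).
    rewrite N. do 2 f_equal. ring.
  - rewrite L3. f_equal. ring.
  - rewrite L2. f_equal. ring.
  - rewrite L4. f_equal. ring.
  - rewrite HD, HF. split; [|ring]. by_coordinates; field. }
split; intros t Ht; apply (main t Ht).
Qed.

Lemma nsq_arm_pos n x : 0 < nsq (dirB n x * RtoC (bar n))%C.
Proof. rewrite nsq_arm. pose proof (bar_pos n). now apply Rmult_lt_0_compat. Qed.

Lemma det_frame P z u v w :
  det ((P + z * v) - (P + z * u))%C ((P + z * w) - (P + z * u))%C = nsq z * det (v - u)%C (w - u)%C.
Proof. rewrite <- det_mult. f_equal; ring. Qed.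

Lemma nsq_neq v w : nsq (v - w)%C <> 0 -> v <> w.
Proof. intros H ->; apply H. unfold nsq; simpl; ring. Qed.

Lemma chain_sign_neq_0 n : chain_sign n <> 0.
Proof. intros E. pose proof (chain_sign_sqr n) as H. rewrite E in H. lra. Qed.

(** Vertex 3 is an intersection point of the unit circles around vertices 1
    and 2, which cross transversally for 0 < x < pi; all others lie on the
    bars from it to vertices 1 and 2. *)
Lemma agree_base c phi q : same_lengths c phi q ->
  agree c phi q 0 0 -> agree c phi q 0 1 -> agree c phi q 0 2 ->
  forall k, (k < 13)%nat -> agree c phi q 0 k.
Proof.
intros SL A0 A1 A2.
assert (A3 : agree c phi q 0 3).
{ apply (agree_dyad c phi q 0 3 0 1 0 2); auto; try lia; try (simpl; auto).
  intros t Ht. pose proof (sin_gt_0 (phi t)). pose proof (sl_range _ _ _ SL t Ht).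
  unfold det, cis; simpl. nra. }
assert (far1 : forall t, interval 0 1 t -> slot c (phi t) 0 1 <> slot c (phi t) 0 3).
{ intros t _. apply nsq_neq. unfold nsq; simpl. lra. }
assert (far2 : forall t, interval 0 1 t -> slot c (phi t) 0 2 <> slot c (phi t) 0 3).
{ intros t _. apply nsq_neq. unfold slot. replace (cis (phi t) - 0)%C with (cis (phi t)) by ring.
  rewrite nsq_cis. lra. }
assert (B1 : forall k, (k < 13)%nat -> In (0, 1)%nat (parents 0 k) -> In (0, 3)%nat (parents 0 k) ->
  (exists r : R, forall x, slot c x 0 k = RtoC r) -> agree c phi q 0 k).
{ intros k Hk I1 I3 [r Hr]. apply (agree_collinear c phi q 0 k 0 1 0 3); auto.
  intros t _. rewrite Hr. unfold det; simpl. ring. }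
assert (B2 : forall k, (k < 13)%nat -> In (0, 2)%nat (parents 0 k) -> In (0, 3)%nat (parents 0 k) ->
  (exists r : R, forall x, slot c x 0 k = (cis x * RtoC r)%C) -> agree c phi q 0 k).
{ intros k Hk I1 I3 [r Hr]. apply (agree_collinear c phi q 0 k 0 2 0 3); auto.
  intros t _. rewrite Hr. unfold det; simpl. ring. }
intros k Hk.
do 13 (try (destruct k as [|k]; [try assumption|])); try lia;
first
 [ apply B1; [lia | simpl; auto | simpl; auto | exists 1; reflexivity ]
 | apply B1; [lia | simpl; auto | simpl; auto | exists (/ 2); reflexivity ]
 | apply B2; [lia | simpl; auto | simpl; auto | exists (/ 2); reflexivity ]
 | apply B2; [lia | simpl; auto | simpl; auto | exists 1; intros; unfold slot; ring ] ].
Qed.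

(** Reflector, step, midpoint and the four transports, in this order. The step
    is a dyad with constant nonzero determinant or, when the coefficient is
    real, a collinear point. *)
Lemma agree_step c phi q m : same_lengths c phi q ->
  (forall k, (k < 13)%nat -> agree c phi q m k) ->
  forall k, (k < 13)%nat -> agree c phi q (S m) k.
Proof.
intros SL IH.
assert (Hs : forall t, interval 0 1 t -> chain_sign m * sin (phi t) <> 0).
{ intros t Ht. pose proof (sin_gt_0 (phi t)). pose proof (sl_range _ _ _ SL t Ht).
  apply Rmult_integral_contrapositive. split; [apply chain_sign_neq_0|lra]. }
assert (A0 : agree c phi q (S m) 0).
{ apply (agree_dyad c phi q (S m) 0 m 6 m 8); auto; try lia; try apply IH; try lia; try (simpl; tauto).
  intros t Ht. rewrite (slot_A_rel c _ m), (slot_B_rel c _ m). unfold slot.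
  rewrite det_frame, det_reflY. pose proof (nsq_arm_pos m (phi t)). specialize (Hs t Ht).
  apply Rmult_integral_contrapositive; split; lra. }
assert (A1 : agree c phi q (S m) 1).
{ apply (agree_collinear c phi q (S m) 1 m 8 (S m) 0); auto; try lia; try apply IH; try lia; try (simpl; tauto).
  - intros t Ht. apply not_eq_sym, nsq_neq. rewrite (slot_B_rel c _ m). unfold slot.
    rewrite nsq_frame, reflY_B_length by apply chain_sign_sqr. pose proof (nsq_arm_pos m (phi t)). lra.
  - intros t Ht. rewrite (slot_B_rel c _ m). unfold slot. rewrite det_frame, reflY'_reflY.
    unfold det; simpl. ring. }
assert (A2 : agree c phi q (S m) 2).
{ apply (agree_dyad c phi q (S m) 2 m 3 (S m) 1); auto; try lia; try apply IH; try lia; try (simpl; tauto).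
  intros t Ht. rewrite (slot_tip c _ m). unfold slot.
  pose proof (det_frame (tip c (phi t) m) (dirB m (phi t) * RtoC (bar m))%C 0%C
    (reflY' (chain_sign m) (phi t)) (turn (chain_sign m) (phi t) * RtoC (/ 4))%C) as E.
  rewrite Cmult_0_r, Cplus_0_r in E. rewrite E.
  replace (reflY' (chain_sign m) (phi t) - 0)%C with (reflY' (chain_sign m) (phi t)) by ring.
  replace (turn (chain_sign m) (phi t) * RtoC (/ 4) - 0)%C with (turn (chain_sign m) (phi t) * RtoC (/ 4))%C by ring.
  rewrite det_reflY'_turn. pose proof (nsq_arm_pos m (phi t)). specialize (Hs t Ht). pose proof (cos_den (phi t)).
  apply Rmult_integral_contrapositive; split; [lra|].
  apply Rmult_integral_contrapositive; split; [lra|]. apply Rinv_neq_0_compat; lra. }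
assert (A3 : agree c phi q (S m) 3).
{ assert (E : forall x, det (slot c x m 8 - slot c x m 3)%C (slot c x (S m) 3 - slot c x m 3)%C
     = bar m / 2 * snd (c m)).
  { intros x. rewrite slot_B, (slot_tip c x m). unfold slot.
    replace (tip c x m + dirB m x * RtoC (bar m / 2) - tip c x m)%C with (dirB m x * RtoC (bar m / 2))%C by ring.
    replace (tip c x m + c m * dirB m x - tip c x m)%C with (dirB m x * c m)%C by ring.
    rewrite det_mult, nsq_dirB. unfold det; simpl; ring. }
  pose proof (bar_pos m).
  destruct (Req_dec (snd (c m)) 0) as [e|e].
  - apply (agree_collinear c phi q (S m) 3 m 3 m 8); auto; try lia; try apply IH; try lia; try (simpl; tauto).
    + intros t Ht. apply not_eq_sym, nsq_neq. rewrite slot_B, (slot_tip c _ m).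
      replace (tip c (phi t) m + dirB m (phi t) * RtoC (bar m / 2) - tip c (phi t) m)%C
        with (dirB m (phi t) * RtoC (bar m / 2))%C by ring.
      rewrite nsq_mult, nsq_dirB, nsq_RtoC.
      assert (0 < bar m / 2 * (bar m / 2)) by (apply Rmult_lt_0_compat; lra). lra.
    + intros t Ht. rewrite E, e. ring.
  - apply (agree_dyad c phi q (S m) 3 m 3 m 8); auto; try lia; try apply IH; try lia; try (simpl; tauto).
    intros t Ht. rewrite E. apply Rmult_integral_contrapositive; split; lra. }
assert (A4 : agree c phi q (S m) 4).
{ intros t Ht.
  pose proof (sl_edge _ _ _ SL (S m) 4%nat m 3%nat ltac:(lia) ltac:(simpl; tauto) t Ht) as L1.
  pose proof (sl_edge _ _ _ SL (S m) 4%nat (S m) 3%nat ltac:(lia) ltac:(simpl; tauto) t Ht) as L2.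
  rewrite (IH 3%nat ltac:(lia) t Ht) in L1. rewrite (A3 t Ht) in L2.
  rewrite (slot_tip c _ m) in L1.
  set (x := phi t) in *. unfold slot in *.
  set (d := (c m * dirB m x)%C) in *. set (P := tip c x m) in *.
  assert (N : forall v, nsq (v * RtoC (/ 2))%C = nsq v / 4).
  { intros; rewrite nsq_mult, nsq_RtoC; field. }
  rewrite (midpoint_unique P (P + d)%C (q (S m) 4%nat t)).
  - by_coordinates; field.
  - rewrite L1. replace (P + d * RtoC (/ 2) - P)%C with (d * RtoC (/ 2))%C by ring.
    rewrite N. do 2 f_equal. ring.
  - rewrite L2. replace (P + d * RtoC (/ 2) - (P + d))%C with (d * RtoC (/ 2) * RtoC (- 1))%C by (by_coordinates; field).
    rewrite nsq_mult, N, nsq_RtoC. replace (P + d - P)%C with d by ring. field. }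
destruct (agree_transport c phi q m 5 m 10) as [A5 A6]; auto; try lia; try (simpl; tauto); try (apply IH; lia).
{ intros x. rewrite (slot_A' c x m). reflexivity. }
{ intros x. rewrite (slot_A' c x m). reflexivity. }
destruct (agree_transport c phi q m 7 m 12) as [A7 A8]; auto; try lia; try (simpl; tauto); try (apply IH; lia).
{ intros x. rewrite (slot_B' c x m). reflexivity. }
{ intros x. rewrite (slot_B' c x m). reflexivity. }
destruct (agree_transport c phi q m 9 m 8) as [A9 A10]; auto; try lia; try (simpl; tauto); try (apply IH; lia).
{ intros x. rewrite (slot_B_rel c x m). reflexivity. }
{ intros x. rewrite (slot_B_rel c x m). reflexivity. }
destruct (agree_transport c phi q m 11 (S m) 2) as [A11 A12]; auto; try lia; try (simpl; tauto).
intros k Hk.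
do 13 (try (destruct k as [|k]; [assumption|])); lia.
Qed.

Lemma agree_all c phi q : same_lengths c phi q ->
  agree c phi q 0 0 -> agree c phi q 0 1 -> agree c phi q 0 2 ->
  forall n k, (k < 13)%nat -> agree c phi q n k.
Proof.
intros SL A0 A1 A2 n; induction n as [|n IH].
- now apply agree_base.
- now apply agree_step.
Qed.

(** * The framework on the natural numbers *)

(** The increasing enumeration, obtained by iterating least elements. *)
Lemma infinite_enumeration (P : nat -> Prop) : (forall M, exists m, (M <= m)%nat /\ P m) ->
  exists f : nat -> nat, (forall k, P (f k)) /\ (forall k l, (k < l)%nat -> (f k < f l)%nat) /\
    (forall m, P m -> exists k, f k = m).
Proof.
intros Hinf.
assert (Hleast : forall M, exists m, (M <= m)%nat /\ P m /\ forall m', (M <= m')%nat -> P m' -> (m <= m')%nat).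
{ intros M.
  destruct (dec_inh_nat_subset_has_unique_least_element (fun m => (M <= m)%nat /\ P m)) as [m [[[H1 H2] H3] _]].
  - intros n. apply classic.
  - apply Hinf.
  - exists m. repeat split; auto. }
destruct (choice _ Hleast) as [next Hnext].
set (f := fix f k := match k with O => next 0%nat | S k => next (S (f k)) end).
assert (Hstep : forall k, (f k < f (S k))%nat).
{ intros k. simpl. destruct (Hnext (S (f k))) as [H _]. lia. }
assert (Hmono : forall k l, (k < l)%nat -> (f k < f l)%nat).
{ intros k l H. induction H. apply Hstep. specialize (Hstep m). lia. }
exists f. repeat split; auto.
- intros [|k]; simpl; apply Hnext.
- intros m Hm. apply NNPP. intros Hno.
  assert (Hle : forall k, (f k <= m)%nat).
  { induction k as [|k IH]; simpl.
    - apply Hnext; auto. lia.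
    - apply Hnext; auto. assert (f k <> m) by (intros E; apply Hno; now exists k). lia. }
  assert (Hge : forall k, (k <= f k)%nat).
  { induction k as [|k IH]. lia. specialize (Hstep k). lia. }
  specialize (Hle (S m)). specialize (Hge (S m)). lia.
Qed.

Lemma uniform_bound (Q : nat -> nat -> Prop) K :
  (forall k N N', (N <= N')%nat -> Q k N -> Q k N') ->
  (forall k, (k < K)%nat -> exists N, Q k N) -> exists N, forall k, (k < K)%nat -> Q k N.
Proof.
intros Hm; induction K as [|K IH]; intros H.
- exists 0%nat; intros; lia.
- destruct IH as [N1 HN1]; [intros; apply H; lia|].
  destruct (H K) as [N2 HN2]; [lia|].
  exists (N1 + N2)%nat. intros k Hk. destruct (Nat.eq_dec k K) as [->|].
  + apply Hm with N2; auto; lia.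
  + apply Hm with N1; [lia|]. apply HN1; lia.
Qed.

(** Edges are enumerated through a pairing function; only finitely many codes
    have both entries below a given bound, so the later end of the edge tends
    to infinity. *)
Lemma edge_enumeration_exists F :
  (forall N, exists i j, (N <= j)%nat /\ (i < j)%nat /\ adj F i j) ->
  exists e, edge_enumeration F e /\ forall N, exists K, forall k, (K <= k)%nat -> (N <= snd (e k))%nat.
Proof.
intros Hinf.
destruct (infinite_enumeration (fun m => (fst (of_nat m) < snd (of_nat m))%nat /\
   adj F (fst (of_nat m)) (snd (of_nat m)))) as [f [Hf [Hmono Hsurj]]].
{ intros M. destruct (Hinf M) as (i & j & HM & Hij & Ha). exists (to_nat (i, j)).
  rewrite cancel_of_to. simpl. split; auto. pose proof (to_nat_non_decreasing i j). lia. }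
exists (fun k => of_nat (f k)). split; [split; [|split]|].
- exact Hf.
- intros k l E. apply of_nat_inj in E.
  destruct (Nat.lt_trichotomy k l) as [H|[H|H]]; auto; apply Hmono in H; lia.
- intros i j Hij Ha. destruct (Hsurj (to_nat (i, j))) as [k Hk].
  + rewrite cancel_of_to. auto.
  + exists k. rewrite Hk. apply cancel_of_to.
- intros N.
  destruct (uniform_bound (fun i B => forall j, (j < N)%nat -> (to_nat (i, j) < B)%nat) N) as [B HB].
  { intros k B B' HBB H j Hj. specialize (H j Hj). lia. }
  { intros i _. destruct (uniform_bound (fun j B => (to_nat (i, j) < B)%nat) N) as [B HB].
    - intros; lia.
    - intros j _. exists (S (to_nat (i, j))). lia.
    - exists B. auto. }
  exists B. intros k Hk. 
  assert (Hge : (k <= f k)%nat).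
  { clear Hk. induction k as [|k IH]. lia. specialize (Hmono k (S k)). lia. }
  destruct (Nat.le_gt_cases N (snd (of_nat (f k)))) as [|Hlt]; auto.
  destruct (Hf k) as [Hlt2 _].
  specialize (HB (fst (of_nat (f k))) ltac:(lia) (snd (of_nat (f k))) Hlt).
  rewrite <- surjective_pairing, cancel_to_of in HB. lia.
Qed.

(** Both ends of the edge number [k] tend to infinity with [k], hence their
    positions have the same limit. *)
Lemma pointed_of_convergent F l d :
  tends (Defs.pos F) l -> (forall i j, adj F i j -> (i <= j + d)%nat) ->
  (forall N, exists i j, (N <= j)%nat /\ (i < j)%nat /\ adj F i j) -> pointed F.
Proof.
intros Hl Hgap Hinf. split; [now exists l|].
destruct (edge_enumeration_exists F Hinf) as [e [He Hinfty]].
exists e; split; auto.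
assert (L2 : tends (fun k => Defs.pos F (snd (e k))) l).
{ apply (filterlim_comp _ _ _ (fun k => snd (e k)) (Defs.pos F) _ eventually); auto.
  intros P [N HN]. destruct (Hinfty N) as [K HK]. exists K. intros; apply HN; auto. }
assert (L1 : tends (fun k => Defs.pos F (fst (e k))) l).
{ apply (filterlim_comp _ _ _ (fun k => fst (e k)) (Defs.pos F) _ eventually); auto.
  intros P [N HN]. destruct (Hinfty (N + d)%nat) as [K HK]. exists K. intros k Hk. apply HN.
  specialize (HK k Hk). destruct He as [He _]. destruct (He k) as [_ Ha].
  apply adj_sym, Hgap in Ha. lia. }
assert (L : tends (fun k => Defs.pos F (fst (e k)) + (RtoC (- 1) * Defs.pos F (snd (e k))))%C 0%C).
{ apply tends_pair in L1 as [H1 H2]. apply tends_pair in L2 as [H3 H4].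
  apply tends_pair; split; simpl.
  - apply is_lim_seq_ext with (fun k => fst (Defs.pos F (fst (e k))) - fst (Defs.pos F (snd (e k)))).
    intros; ring. replace (Finite 0) with (Finite (fst l - fst l)) by (f_equal; ring).
    now apply is_lim_seq_minus'.
  - apply is_lim_seq_ext with (fun k => snd (Defs.pos F (fst (e k))) - snd (Defs.pos F (snd (e k)))).
    intros; ring. replace (Finite 0) with (Finite (snd l - snd l)) by (f_equal; ring).
    now apply is_lim_seq_minus'. }
apply tends_0 in L.
apply is_lim_seq_ext with (fun k => sqrt (nsq (Defs.pos F (fst (e k)) + (RtoC (- 1) * Defs.pos F (snd (e k))))%C)).
- intros k. rewrite dist_nsq. do 2 f_equal. ring.
- rewrite <- sqrt_0. apply is_lim_seq_continuous; auto. apply continuity_pt_sqrt; lra.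
Qed.

Lemma tends_blocks (x : nat -> nat -> C) K l : (0 < K)%nat ->
  (forall k, (k < K)%nat -> tends (fun n => x n k) l) -> tends (fun i => x (i / K) (i mod K))%nat l.
Proof.
intros HK H P HP.
destruct (uniform_bound (fun k N => forall n, (N <= n)%nat -> P (x n k)) K) as [N HN].
- intros k N N' HNN H' n Hn. apply H'. lia.
- intros k Hk. apply (H k Hk P HP).
- exists (K * N)%nat. intros i Hi. apply HN.
  + apply Nat.mod_upper_bound; lia.
  + apply Nat.div_le_lower_bound; lia.
Qed.

Lemma tends_small (y : nat -> C) (s : nat -> R) K : is_lim_seq s 0 ->
  (forall n, nsq (y n) = s n * s n * K) -> tends y 0%C.
Proof.
intros Hs Hy. apply tends_0. apply is_lim_seq_ext with (fun n => s n * s n * K); auto.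
replace (Finite 0) with (Finite (0 * 0 * K)) by (f_equal; ring).
repeat apply is_lim_seq_mult'; auto. apply is_lim_seq_const.
Qed.

Lemma nsq_reflY s x : s * s = 1 -> nsq (reflY s x) = nsq (reflY 1 x).
Proof.
intros H; unfold nsq, reflY; simpl. set (r := -3 / (5 - 4 * cos x)).
replace (r * (s * sin x) * (r * (s * sin x))) with (s * s * (r * sin x * (r * sin x))) by ring.
rewrite H; ring.
Qed.

Lemma nsq_reflY' s x : s * s = 1 -> nsq (reflY' s x) = nsq (reflY' 1 x).
Proof.
intros H; unfold nsq, reflY'; simpl. set (r := 3 / 4 / (5 - 4 * cos x)).
replace (- (r * (s * sin x)) * - (r * (s * sin x))) with (s * s * (r * sin x * (r * sin x))) by ring.
rewrite H; ring.
Qed.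

(** Consecutive partial sums become close because they converge, and the bars
    shrink: all vertices of a block are absorbed in the limit of the base
    points. *)
Lemma slot_tends c x l k : (k < 13)%nat -> tends (tip c x) l -> tends (fun n => slot c x n k) l.
Proof.
intros Hk Hl.
assert (Hd : tends (fun m => c m * dirB m x)%C 0%C).
{ apply tends_ext with (fun m => tip c x (S m) + RtoC (- 1) * tip c x m)%C.
  { intros; simpl. ring. }
  pose proof (proj2 (tends_incr (tip c x) l) Hl) as Hl'.
  apply tends_pair in Hl as [H1 H2]. apply tends_pair in Hl' as [H3 H4].
  apply tends_pair; split; cbn -[tip].
  - apply is_lim_seq_ext with (fun m => fst (tip c x (S m)) - fst (tip c x m)).
    intros; ring. replace (Finite 0) with (Finite (fst l - fst l)) by (f_equal; ring).
    now apply is_lim_seq_minus'.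
  - apply is_lim_seq_ext with (fun m => snd (tip c x (S m)) - snd (tip c x m)).
    intros; ring. replace (Finite 0) with (Finite (snd l - snd l)) by (f_equal; ring).
    now apply is_lim_seq_minus'. }
assert (Hh : tends (fun m => c m * dirB m x * RtoC (/ 2))%C 0%C).
{ apply tends_ext with (fun m => RtoC (/ 2) * (c m * dirB m x))%C. intros; ring. now apply tends_scal. }
assert (S0 := bar_lim). assert (S1 := proj1 (is_lim_seq_incr_1 bar 0) S0).
assert (add : forall y z, tends y l -> tends z 0%C -> tends (fun m => y m + z m)%C l).
{ intros y z Hy Hz. replace l with (l + 0)%C by ring. now apply tends_plus. }
apply tends_incr.
assert (HY : tends (fun m => dirB m x * RtoC (bar m) * reflY (chain_sign m) x)%C 0%C).
{ apply tends_small with bar (nsq (reflY 1 x)); auto. intros m.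
  rewrite nsq_mult, nsq_arm, nsq_reflY; auto. apply chain_sign_sqr. }
assert (HY' : tends (fun m => dirB m x * RtoC (bar m) * reflY' (chain_sign m) x)%C 0%C).
{ apply tends_small with bar (nsq (reflY' 1 x)); auto. intros m.
  rewrite nsq_mult, nsq_arm, nsq_reflY'; auto. apply chain_sign_sqr. }
assert (HA : tends (fun m => dirA (S m) x * RtoC (bar (S m)))%C 0%C).
{ apply tends_small with (fun m => bar (S m)) 1; auto. intros m.
  rewrite nsq_mult, nsq_RtoC, nsq_dirA. ring. }
assert (HB : tends (fun m => dirB (S m) x * RtoC (bar (S m) / 2))%C 0%C).
{ apply tends_small with (fun m => bar (S m)) (/ 4); auto. intros m.
  rewrite nsq_mult, nsq_RtoC, nsq_dirB. field. }
assert (HC : tends (fun m => dirB m x * RtoC (bar m) * RtoC (/ 2))%C 0%C).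
{ apply tends_small with bar (/ 4); auto. intros m.
  rewrite nsq_mult, nsq_RtoC, nsq_arm. field. }
assert (HD : tends (fun m => dirB m x * RtoC (bar m) * (turn (chain_sign m) x * RtoC (/ 4)))%C 0%C).
{ apply tends_small with bar (/ 16); auto. intros m.
  rewrite !nsq_mult, !nsq_RtoC, nsq_dirB, nsq_turn by apply chain_sign_sqr. field. }
unfold slot.
do 13 (try (destruct k as [|k]; [repeat (apply add; auto)|])). lia.
Qed.

Definition vertex (p : nat * nat) : nat := (13 * fst p + snd p)%nat.
Definition parent (i j : nat) : Prop := In j (map vertex (parents (i / 13) (i mod 13))).

Lemma parents_lt n k p : (k < 13)%nat -> In p (parents n k) ->
  (snd p < 13)%nat /\ (vertex p < 13 * n + k)%nat /\ (13 * n + k <= vertex p + 26)%nat.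
Proof.
intros Hk Hp. unfold vertex.
destruct n as [|m]; do 13 (try (destruct k as [|k]; [list_cases Hp|])); lia.
Qed.

Lemma index_eq i : i = (13 * (i / 13) + i mod 13)%nat /\ (i mod 13 < 13)%nat.
Proof. split; [apply Nat.div_mod_eq|apply Nat.mod_upper_bound; lia]. Qed.

Lemma parent_lt i j : parent i j -> (j < i <= j + 26)%nat.
Proof.
intros H. apply in_map_iff in H as [p [<- Hp]].
destruct (index_eq i) as [E Hk]. destruct (parents_lt _ _ _ Hk Hp) as (H1 & H2 & H3). lia.
Qed.

Definition linked (i j : nat) : Prop := parent i j \/ parent j i.

Lemma linked_sym i j : linked i j -> linked j i.
Proof. unfold linked; tauto. Qed.

Lemma linked_irrefl i : ~ linked i i.
Proof. intros [H|H]; apply parent_lt in H; lia. Qed.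

Definition joint (c : nat -> C) (x : R) (i : nat) : C := slot c x (i / 13) (i mod 13).

Definition rotor_framework (c : nat -> C) (x : R) : infinite_framework :=
  {| adj := linked; adj_sym := linked_sym; adj_irrefl := linked_irrefl; Defs.pos := joint c x |}.

Lemma div_mod_vertex n k : (k < 13)%nat -> ((13 * n + k) / 13 = n /\ (13 * n + k) mod 13 = k)%nat.
Proof.
intros H. destruct (index_eq (13 * n + k)) as [E Hk]. lia.
Qed.

Lemma joint_vertex c x n k : (k < 13)%nat -> joint c x (13 * n + k) = slot c x n k.
Proof. intros H; unfold joint. destruct (div_mod_vertex n k H) as [-> ->]. reflexivity. Qed.

Lemma parent_vertex n k p : (k < 13)%nat -> In p (parents n k) -> parent (13 * n + k) (vertex p).
Proof.
intros H Hp; unfold parent. destruct (div_mod_vertex n k H) as [-> ->]. now apply in_map.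
Qed.

Lemma parent_length c i j x y : parent i j ->
  nsq (joint c x i - joint c x j)%C = nsq (joint c y i - joint c y j)%C.
Proof.
intros H. apply in_map_iff in H as [p [<- Hp]].
destruct (index_eq i) as [E Hk]. destruct (parents_lt _ _ _ Hk Hp) as (H1 & _ & _).
unfold vertex. rewrite !(joint_vertex c _ (fst p) (snd p)) by auto. unfold joint.
destruct (i / 13)%nat as [|m].
- destruct (edge_rigid_0 c _ p Hk Hp) as [L HL]. now rewrite !HL.
- destruct (edge_rigid_S c m _ p Hk Hp) as [L HL]. now rewrite !HL.
Qed.

Lemma nsq_sym (v w : C) : nsq (v - w)%C = nsq (w - v)%C.
Proof. unfold nsq; simpl; ring. Qed.

Lemma linked_length c i j x y : linked i j ->
  nsq (joint c x i - joint c x j)%C = nsq (joint c y i - joint c y j)%C.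
Proof.
intros [H|H]; [now apply parent_length|].
rewrite (nsq_sym (joint c x i)), (nsq_sym (joint c y i)). now apply parent_length.
Qed.

Lemma has_parent i : (0 < i)%nat -> exists j, parent i j.
Proof.
intros Hi. destruct (index_eq i) as [E Hk].
assert (H : exists p, In p (parents (i / 13) (i mod 13))).
{ destruct (i / 13)%nat as [|m]; set (k := (i mod 13)%nat) in *; clearbody k;
  do 13 (try (destruct k as [|k]; [first [lia | eexists; simpl; left; reflexivity]|])); lia. }
destruct H as [p Hp]. exists (vertex p). now apply in_map.
Qed.

Lemma rotor_connected c x : connected (rotor_framework c x).
Proof.
assert (H0 : forall i, clos_refl_trans nat linked i 0%nat /\ clos_refl_trans nat linked 0%nat i).
{ induction i as [i IH] using lt_wf_ind.
  destruct (Nat.eq_dec i 0) as [->|Hi]; [split; apply rt_refl|].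
  destruct (has_parent i) as [j Hj]; [lia|].
  destruct (IH j) as [H1 H2]; [apply parent_lt in Hj; lia|].
  split.
  - apply rt_trans with j; auto. apply rt_step. now left.
  - apply rt_trans with j; auto. apply rt_step. now right. }
intros i j. apply rt_trans with 0%nat; apply H0.
Qed.

Lemma linked_gap i j : linked i j -> (i <= j + 26)%nat.
Proof. intros [H|H]; apply parent_lt in H; lia. Qed.

Lemma rotor_locally_finite c x : locally_finite (rotor_framework c x).
Proof.
intros i. exists (seq 0 (i + 27)). intros j H. apply in_seq.
apply linked_sym, linked_gap in H. lia.
Qed.

Lemma linked_0 j : linked 0 j <-> j = 1%nat \/ j = 2%nat.
Proof.
split.
- intros [H|H]; [apply parent_lt in H; lia|].
  apply in_map_iff in H as [p [E Hp]]. destruct (index_eq j) as [Ej Hk].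
  rewrite Ej. unfold vertex in E.
  destruct (j / 13)%nat as [|m]; set (k := (j mod 13)%nat) in *; clearbody k;
  do 13 (try (destruct k as [|k]; [list_cases Hp; simpl in E; lia|])); lia.
- intros [-> | ->]; right; unfold parent; simpl; auto.
Qed.

Lemma rotor_pointed c x l : tends (tip c x) l -> pointed (rotor_framework c x) /\ tends (joint c x) l.
Proof.
intros Hl.
assert (H : tends (joint c x) l).
{ apply (tends_blocks (slot c x) 13); [lia|]. intros; now apply slot_tends. }
split; auto. apply pointed_of_convergent with l 26%nat; auto.
- intros i j; apply linked_gap.
- intros N. destruct (has_parent (S N)) as [j Hj]; [lia|].
  pose proof (parent_lt _ _ Hj). exists j, (S N). repeat split; try lia. now right.
Qed.

(** Any coefficients and any decreasing motion of the input angle within (0,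
    pi) give a plane linkage; its base edge joins the vertices 0 and 1. *)
Theorem rotor_linkage (c : nat -> C) (phi : R -> R) :
  (forall t, continuous phi t) ->
  (forall t, interval 0 1 t -> 0 < phi t < PI) ->
  (forall s t, interval 0 1 s -> interval 0 1 t -> s < t -> phi t < phi s) ->
  plane_linkage (rotor_framework c (phi 0)) (fun t => joint c (phi t)).
Proof.
intros Hc Hr Hm.
assert (I0 : interval 0 1 0) by (unfold interval; lra).
assert (I1 : interval 0 1 1) by (unfold interval; lra).
assert (Hcos : forall s t, interval 0 1 s -> interval 0 1 t -> s < t -> cos (phi s) < cos (phi t)).
{ intros s t Hs Ht Hst. pose proof (Hr s Hs). pose proof (Hr t Ht). pose proof (Hm s t Hs Ht Hst).
  apply cos_decreasing_1; lra. }
split; [apply rotor_connected|]. split; [apply linked_0|]. split; [|split; [|split]].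
- split; [reflexivity|]. split; [|split; [|split]].
  + intros i. apply slot_continuous_on; auto.
  + exists 0%nat, 1%nat. split; [apply linked_0; auto|]. split.
    * rewrite dist_nsq. unfold nsq; simpl. 
      intros E. apply sqrt_eq_0 in E; lra.
    * intros t _. split; reflexivity.
  + intros i j t Ha Ht. apply dist_eq_nsq. now apply linked_length.
  + exists 0, 1, 2%nat. split; auto. split; auto.
    unfold joint; simpl. unfold cis. intros E. injection E as E _.
    pose proof (Hcos 0 1 I0 I1 ltac:(lra)). lra.
- intros s t Hs Ht Hst. unfold cos_angle, inner, vec, joint; simpl.
  pose proof (Hcos s t Hs Ht Hst). lra.
- intros q Hq Hagree.
  destruct Hq as (Q0 & Qc & _ & Qe & _).
  assert (SL : same_lengths c phi (fun n k t => q t (13 * n + k)%nat)).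
  { constructor; auto.
    - intros n k Hk. rewrite Q0. now apply joint_vertex.
    - intros n k n' k' Hk Hp t Ht.
      pose proof (parent_vertex n k _ Hk Hp) as Hpar. unfold vertex in Hpar; simpl fst in Hpar; simpl snd in Hpar.
      assert (Hk' : (k' < 13)%nat) by apply (parents_lt _ _ _ Hk Hp).
      pose proof (Qe _ _ t (or_introl Hpar) Ht) as E. apply dist_eq_nsq in E.
      etransitivity; [exact E|]. rewrite !Q0. simpl Defs.pos.
      rewrite <- (joint_vertex c _ n k Hk), <- (joint_vertex c _ n' k' Hk').
      now apply parent_length. }
  intros t i Ht. destruct (index_eq i) as [E Hk].
  rewrite E at 1. unfold joint.
  apply (agree_all c phi _ SL); auto; intros s Hs; apply (Hagree s); auto; lia.
- reflexivity.
Qed.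

(** * Realising trigonometric series, and the theorem *)

Lemma frequency_chain_sign k : frequency (2 * k) = INR (S k) /\ frequency (S (2 * k)) = - INR k /\ chain_sign (2 * k) = 1 /\ chain_sign (S (2 * k)) = - 1.
Proof.
induction k as [|k (H1 & H2 & H3 & H4)]; [simpl; repeat split; ring|].
replace (2 * S k)%nat with (S (S (2 * k))) by lia.
change (frequency (S (S (2 * k)))) with (frequency (2 * k) + chain_sign (2 * k)).
change (frequency (S (S (S (2 * k))))) with (frequency (S (2 * k)) + chain_sign (S (2 * k))).
change (chain_sign (S (S (2 * k)))) with (chain_sign (2 * k)).
change (chain_sign (S (S (S (2 * k))))) with (chain_sign (S (2 * k))).
rewrite H1, H2, H3, H4, !S_INR. repeat split; ring.
Qed.

(** The coefficient of z^k, respectively z^-k, in A cos (k x) + B sin (k x),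
    where A = (al1 k, al2 k) and B = (be1 k, be2 k) are read as complex
    numbers: (A - i B) / 2 and (A + i B) / 2. *)
Definition coef_pos (al1 be1 al2 be2 : nat -> R) (k : nat) : C := ((al1 k + be2 k) / 2, (al2 k - be1 k) / 2).
Definition coef_neg (al1 be1 al2 be2 : nat -> R) (k : nat) : C :=
  match k with O => (al1 O, al2 O) | S _ => ((al1 k - be2 k) / 2, (al2 k + be1 k) / 2) end.

Definition rotor_coef (al1 be1 al2 be2 : nat -> R) (n : nat) : C :=
  if Nat.even n then coef_pos al1 be1 al2 be2 (S (n / 2)) else coef_neg al1 be1 al2 be2 (n / 2).

Lemma rotor_coef_even a b c d k : rotor_coef a b c d (2 * k) = coef_pos a b c d (S k).
Proof.
unfold rotor_coef. rewrite Nat.even_mul. simpl orb. cbv iota. do 2 f_equal.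
rewrite Nat.mul_comm. apply Nat.div_mul; lia.
Qed.

Lemma rotor_coef_odd a b c d k : rotor_coef a b c d (S (2 * k)) = coef_neg a b c d k.
Proof.
unfold rotor_coef. rewrite Nat.even_succ, Nat.odd_mul. simpl andb. cbv iota. f_equal.
symmetry. apply Nat.div_unique with 1%nat; lia.
Qed.

Definition trig_sum (a b : nat -> R) (x : R) (k : nat) : R :=
  sum_n (fun n => a n * cos (INR n * x) + b n * sin (INR n * x)) k.

Lemma trig_sum_S a b x k : trig_sum a b x (S k) =
  trig_sum a b x k + (a (S k) * cos (INR (S k) * x) + b (S k) * sin (INR (S k) * x)).
Proof. unfold trig_sum; now rewrite sum_Sn. Qed.

(** After an even number of steps the powers z^j and z^-j have been added for
    all j up to [k], and z^(k+1) in advance; this extra term tends to 0. *)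
Lemma tip_even a1 b1 a2 b2 x k :
  tip (rotor_coef a1 b1 a2 b2) x (S (S (2 * k))) =
  ((trig_sum a1 b1 x k, trig_sum a2 b2 x k) +
   coef_pos a1 b1 a2 b2 (S k) * cis (INR (S k) * x))%C.
Proof.
assert (ST : forall n, tip (rotor_coef a1 b1 a2 b2) x (S (S (2 * n))) =
  (tip (rotor_coef a1 b1 a2 b2) x (2 * n) + coef_pos a1 b1 a2 b2 (S n) * cis (INR (S n) * x)
   + coef_neg a1 b1 a2 b2 n * cis (- INR n * x))%C).
{ intros n. change (tip (rotor_coef a1 b1 a2 b2) x (S (S (2 * n)))) with
   (tip (rotor_coef a1 b1 a2 b2) x (2 * n) + rotor_coef a1 b1 a2 b2 (2 * n) * dirB (2 * n) x
    + rotor_coef a1 b1 a2 b2 (S (2 * n)) * dirB (S (2 * n)) x)%C.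
  rewrite rotor_coef_even, rotor_coef_odd. unfold dirB.
  destruct (frequency_chain_sign n) as (-> & -> & _). reflexivity. }
induction k as [|k IH]; rewrite ST.
- unfold trig_sum; rewrite !sum_O. unfold coef_neg, cis.
  replace (- INR 0 * x) with 0 by (simpl; ring). replace (INR 0 * x) with 0 by (simpl; ring).
  rewrite cos_0, sin_0. apply injective_projections; cbn -[coef_pos INR]; ring.
- replace (2 * S k)%nat with (S (S (2 * k))) by lia. rewrite IH, !trig_sum_S.
  replace (- INR (S k) * x) with (- (INR (S k) * x)) by ring.
  set (y := INR (S k) * x). unfold cis at 1 3. rewrite cos_neg, sin_neg.
  apply injective_projections; cbn -[INR]; field.
Qed.

Lemma tends_even_odd x l : tends (fun k => x (2 * k)%nat) l -> tends (fun k => x (S (2 * k))) l -> tends x l.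
Proof.
intros H0 H1 P HP. destruct (H0 P HP) as [N0 HN0]. destruct (H1 P HP) as [N1 HN1].
exists (2 * (N0 + N1))%nat. intros n Hn.
destruct (Nat.Even_or_Odd n) as [[k ->]|[k ->]].
- apply HN0; lia.
- replace (2 * k + 1)%nat with (S (2 * k)) by lia. apply HN1; lia.
Qed.

Lemma tip_tends D g1 g2 a1 b1 a2 b2 x :
  trig_expansion D g1 a1 b1 -> trig_expansion D g2 a2 b2 -> D x ->
  tends (tip (rotor_coef a1 b1 a2 b2) x) (g1 x, g2 x).
Proof.
intros (La1 & Lb1 & H1) (La2 & Lb2 & H2) Hx.
assert (Hsmall : tends (fun k => coef_pos a1 b1 a2 b2 (S k) * cis (INR (S k) * x))%C 0%C).
{ apply tends_0. apply is_lim_seq_ext with (fun k => nsq (coef_pos a1 b1 a2 b2 (S k))).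
  - intros; rewrite nsq_mult, nsq_cis; ring.
  - apply tends_0. apply (tends_incr (coef_pos a1 b1 a2 b2)). apply tends_pair; split; simpl; unfold Rdiv.
    + replace (Finite 0) with (Finite ((0 + 0) * / 2)) by (f_equal; ring).
      apply is_lim_seq_mult'; [apply is_lim_seq_plus'; auto|apply is_lim_seq_const].
    + replace (Finite 0) with (Finite ((0 - 0) * / 2)) by (f_equal; ring).
      apply is_lim_seq_mult'; [apply is_lim_seq_minus'; auto|apply is_lim_seq_const]. }
assert (Heven : tends (fun k => tip (rotor_coef a1 b1 a2 b2) x (S (S (2 * k)))) (g1 x, g2 x)).
{ eapply tends_ext; [intros k; symmetry; apply tip_even|].
  replace (g1 x, g2 x) with ((g1 x, g2 x) + 0)%C by (apply injective_projections; simpl; ring).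
  apply tends_plus; auto. apply tends_pair; split; [apply (H1 x Hx)|apply (H2 x Hx)]. }
apply (proj1 (tends_incr (tip _ x) _)), (proj1 (tends_incr (fun n => tip _ x (S n)) _)), tends_even_odd; auto.
eapply tends_ext with (fun k => tip (rotor_coef a1 b1 a2 b2) x (S (S (2 * k))) +
   coef_pos a1 b1 a2 b2 (S (S k)) * cis (INR (S (S k)) * x))%C.
- intros k. 
  change (tip (rotor_coef a1 b1 a2 b2) x (S (S (S (2 * k))))) with
   (tip (rotor_coef a1 b1 a2 b2) x (S (S (2 * k))) + rotor_coef a1 b1 a2 b2 (S (S (2 * k))) * dirB (S (S (2 * k))) x)%C.
  replace (S (S (2 * k))) with (2 * S k)%nat by lia.
  rewrite rotor_coef_even. unfold dirB. destruct (frequency_chain_sign (S k)) as (-> & _). reflexivity.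
- replace (g1 x, g2 x) with ((g1 x, g2 x) + 0)%C by (apply injective_projections; simpl; ring).
  apply tends_plus; auto.
  apply (tends_incr (fun k => coef_pos a1 b1 a2 b2 (S k) * cis (INR (S k) * x))%C); auto.
Qed.

Theorem theorem5p3 (f : R -> R)
  (f_cont : continuous_on (interval 0 (2 * PI)) f)
  (f_summable : fourier_abs_summable f) :
  exists (F : infinite_framework) (p : R -> nat -> point) (pstar : R -> point),
    plane_linkage F p /\
    locally_finite F /\
    pointed F /\
    (forall t, interval 0 1 t ->
       filterlim (fun n => p t n) eventually (locally (pstar t))) /\
    continuous_on (interval 0 1) pstar /\
    (forall P : point,
       (exists t, interval 0 1 t /\ pstar t = P) <->
       (exists s, interval 0 (2 * PI) s /\ P = (s, f s))).
Proof.
pose proof PI_RGT_0 as HPI.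
destruct (trig_expansion_fourier f f_cont f_summable) as (al & be & H).
apply trig_expansion_stretch in H as (a2 & b2 & H2).
destruct trig_expansion_linear as (a1 & b1 & H1).
set (c := rotor_coef a1 b1 a2 b2).
(* The angle decreases, so that its cosine increases; the graph is then traced
    from right to left. *)
set (phi := fun t => 3 * PI / 4 - PI / 2 * t).
set (s := fun t => 2 * PI * (1 - t)).
assert (Hs : forall t, 4 * phi t - PI = s t) by (intros; unfold phi, s; field).
assert (Hphi : forall t, interval 0 1 t -> interval (PI / 4) (3 * PI / 4) (phi t)).
{ unfold interval, phi; intros t Ht; nra. }
assert (Hsr : forall t, interval 0 1 t -> interval 0 (2 * PI) (s t)).
{ unfold interval, s; intros t Ht; nra. }
assert (Hlim : forall t, interval 0 1 t -> tends (tip c (phi t)) (s t, f (s t))).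
{ intros t Ht. rewrite <- Hs.
  apply (tip_tends _ (fun x => 4 * x - PI) (fun x => f (4 * x - PI)) a1 b1 a2 b2 (phi t) H1 H2 (Hphi t Ht)). }
assert (Hsc : forall t, continuous s t).
{ intros t. apply (ex_derive_continuous s). unfold s. auto_derive. auto. }
assert (I0 : interval 0 1 0) by (unfold interval; lra).
exists (rotor_framework c (phi 0)), (fun t => joint c (phi t)), (fun t => (s t, f (s t))).
split; [|split; [|split; [|split; [|split]]]].
- apply rotor_linkage.
  + intros t. apply (ex_derive_continuous phi). unfold phi. auto_derive. auto.
  + intros t Ht. specialize (Hphi t Ht). unfold interval in Hphi. lra.
  + intros t u _ _ Htu. unfold phi. nra.
- apply rotor_locally_finite.
- exact (proj1 (rotor_pointed c _ _ (Hlim 0 I0))).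
- intros t Ht. exact (proj2 (rotor_pointed c _ _ (Hlim t Ht))).
- apply continuous_on_pair. split; cbv beta; simpl.
  + now apply continuous_everywhere_on.
  + intros t Ht. apply (filterlim_comp _ _ _ s f _ (within (interval 0 (2 * PI)) (locally (s t)))).
    * intros P [e He]. destruct (Hsc t _ (locally_ball (s t) e)) as [d Hd].
      exists d. intros u Hu Iu. apply He. apply (Hd u Hu). now apply Hsr.
    * apply f_cont. now apply Hsr.
- intros P; split.
  + intros (t & Ht & <-). exists (s t). auto.
  + intros (u & Hu & ->). exists (1 - u / (2 * PI)).
    assert (E : s (1 - u / (2 * PI)) = u) by (unfold s; field; lra).
    rewrite E. split; auto. unfold interval in *.
    assert (0 <= u / (2 * PI) <= 1); [|lra]. split.
    * apply Rdiv_le_0_compat; lra.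
    * apply Rmult_le_reg_r with (2 * PI); [lra|]. replace (u / (2 * PI) * (2 * PI)) with u by (field; lra). lra.
Qed.
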